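(* Let $\mathbb{SU}=\prod_{n=1}^\infty SU(n)$. For a comeager set of $G\in\mathcal{S}(\mathbb{SU})$, $G$ contains a non-identity element of finite order and an element of infinite order (i.e. $G$ is neither torsion-free nor a torsion group).
   Context: $\mathbb{SU}$ carries the product topology, metrized by $d(x,y)=\sum_n 2^{-n}d_n(x(n),y(n))$ where $d_n\le 1$ is a biinvariant metric on $SU(n)$. $\mathcal{S}(\mathbb{SU})$ is the set of nonempty compact subgroups of $\mathbb{SU}$ with the Hausdorff metric induced by $d$. *)

(* Defs.v *)
From HB Require Import structures.
From mathcomp Require Import all_boot all_order all_algebra complex.
From mathcomp Require Import all_classical all_reals all_analysis.
From mathcomp Require Import ring lra.

Set Implicit Arguments.
Unset Strict Implicit.
Unset Printing Implicit Defensive.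

Import Order.TTheory GRing.Theory Num.Theory.
Import numFieldTopology.Exports numFieldNormedType.Exports.

Local Open Scope classical_set_scope.
Local Open Scope ring_scope.

(* The cast to numClosedFieldType is what gives R[i] the topology of its
   modulus; the bare type complex R has no topology attached. *)
Definition Cplx (R : realType) : numClosedFieldType := R[i].

Section SpecialUnitary.
Variables (R : realType) (n : nat).

Definition special_unitary : {pred 'M[Cplx R]_n} :=
  [pred A | (A \is unitarymx) && (\det A == 1)].

Record SU := MkSU { SUval : 'M[Cplx R]_n; _ : SUval \in special_unitary }.

HB.instance Definition _ := [isSub for SUval].
HB.instance Definition _ := [Choice of SU by <:].
HB.instance Definition _ := Topological.copy SU (initial_topology SUval).

Lemma SU1_subproof : 1%:M \in special_unitary.
Proof.
by rewrite !inE det1 eqxx andbT; apply/unitarymxP; rewrite mul1mx trmx1 map_mx1. Qed.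

Lemma SUM_subproof (A B : SU) : SUval A *m SUval B \in special_unitary.
Proof.
case: A B => [A] /andP[uA /eqP dA] [B] /andP[uB /eqP dB] /=.
by rewrite inE /= mul_unitarymx//= det_mulmx dA dB mulr1.
Qed.

Lemma SUV_subproof (A : SU) : invmx (SUval A) \in special_unitary.
Proof.
case: A => [A] /andP[uA /eqP dA] /=.
rewrite inE /= det_inv dA invr1 eqxx andbT.
have uu := unitarymx_unit uA.
apply/unitarymxP; rewrite invmx_unitary//.
apply: (can_inj (mulKmx uu)); rewrite mulmxA (unitarymxP uA) mul1mx mulmx1.
by apply/matrixP => i j; rewrite !mxE conjCK.
Qed.

Definition SU1 : SU := MkSU SU1_subproof.
Definition SUM (A B : SU) : SU := MkSU (SUM_subproof A B).
Definition SUV (A : SU) : SU := MkSU (SUV_subproof A).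

Lemma SUunit (A : SU) : SUval A \in unitmx.
Proof. by case: A => A /= /andP[uA _]; exact: unitarymx_unit. Qed.

Lemma SU_mulA : associative SUM.
Proof. by move=> A B D; apply/val_inj; rewrite /= mulmxA. Qed.
Lemma SU_1mul : left_id SU1 SUM.
Proof. by move=> A; apply/val_inj; rewrite /= mul1mx. Qed.
Lemma SU_mul1 : right_id SU1 SUM.
Proof. by move=> A; apply/val_inj; rewrite /= mulmx1. Qed.
Lemma SU_Vmul : left_inverse SU1 SUV SUM.
Proof. by move=> A; apply/val_inj; rewrite /= mulVmx// SUunit. Qed.
Lemma SU_mulV : right_inverse SU1 SUV SUM.
Proof. by move=> A; apply/val_inj; rewrite /= mulmxV// SUunit. Qed.

HB.instance Definition _ :=
  isGroup.Build SU SU_mulA SU_1mul SU_mul1 SU_Vmul SU_mulV.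

(* bm_nbhs says that the metric induces the usual topology of SU(n). *)
Record biinvariant_metric := BiinvariantMetric {
  bm_dist :> SU -> SU -> R ;
  bm_xx : forall x, bm_dist x x = 0 ;
  bm_positivity : forall x y, bm_dist x y = 0 -> x = y ;
  bm_sym : forall x y, bm_dist x y = bm_dist y x ;
  bm_triangle : forall y x z, bm_dist x z <= bm_dist x y + bm_dist y z ;
  bm_invl : forall g x y, bm_dist (g * x)%g (g * y)%g = bm_dist x y ;
  bm_invr : forall g x y, bm_dist (x * g)%g (y * g)%g = bm_dist x y ;
  bm_le1 : forall x y, bm_dist x y <= 1 ;
  bm_nbhs : forall x (A : set SU),
    nbhs x A <-> exists2 e, 0 < e & [set y | bm_dist x y < e] `<=` A
}.

Lemma bm_ge0 (d : biinvariant_metric) x y : 0 <= d x y.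
Proof.
have := bm_triangle d y x x; rewrite bm_xx (bm_sym d y x) -mulr2n.
by rewrite pmulrn_lge0.
Qed.

End SpecialUnitary.

(* The factors are indexed from 0, so the factor SU(n) of the product is the
   one of index n - 1.  The metrics d do not affect the underlying set, group
   or topology; carrying them in the type lets it be a metricType. *)
Definition SUprod (R : realType) (d : forall n, biinvariant_metric R n.+1) :=
  forall n, SU R n.+1.

Section Product.
Variables (R : realType) (d : forall n, biinvariant_metric R n.+1).
Local Notation SUp := (SUprod d).
Implicit Types x y z : SUp.

HB.instance Definition _ :=
  Topological.copy SUp (prod_topology (fun n => SU R n.+1)).

Definition SUprod1 : SUp := fun=> 1%g.
Definition SUprodM x y : SUp := fun n => (x n * y n)%g.
Definition SUprodV x : SUp := fun n => (x n)^-1%g.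

Lemma SUprod_mulA : associative SUprodM.
Proof. by move=> x y z; apply: functional_extensionality_dep => n; exact: mulgA. Qed.
Lemma SUprod_1mul : left_id SUprod1 SUprodM.
Proof. by move=> x; apply: functional_extensionality_dep => n; exact: mul1g. Qed.
Lemma SUprod_mul1 : right_id SUprod1 SUprodM.
Proof. by move=> x; apply: functional_extensionality_dep => n; exact: mulg1. Qed.
Lemma SUprod_Vmul : left_inverse SUprod1 SUprodV SUprodM.
Proof. by move=> x; apply: functional_extensionality_dep => n; exact: mulVg. Qed.
Lemma SUprod_mulV : right_inverse SUprod1 SUprodV SUprodM.
Proof. by move=> x; apply: functional_extensionality_dep => n; exact: mulgV. Qed.

HB.instance Definition _ :=
  isGroup.Build SUp SUprod_mulA SUprod_1mul SUprod_mul1 SUprod_Vmul SUprod_mulV.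

Definition SUprod_term x y (n : nat) : R := 2 ^- n.+1 * d n (x n) (y n).

Definition SUprod_dist x y : R := limn (series (SUprod_term x y)).

Lemma SUprod_term_ge0 x y n : 0 <= SUprod_term x y n.
Proof. by rewrite mulr_ge0 ?bm_ge0// invr_ge0 exprn_ge0. Qed.

Lemma SUprod_series_nd x y : nondecreasing_seq (series (SUprod_term x y)).
Proof. by apply: nondecreasing_series => n _ _; exact: SUprod_term_ge0. Qed.

Lemma SUprod_series_bound x y (N : nat) (c : R) : 0 <= c ->
  (forall n, (n < N)%N -> d n (x n) (y n) <= c) ->
  forall m, series (SUprod_term x y) m <= c + 2 ^- N.
Proof.
move=> c0 dc m.
suff : series (SUprod_term x y) m <=
    c * (1 - 2 ^- m) + (if (m <= N)%N then 0 else 2 ^- N - 2 ^- m).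
  have m0 : 0 <= (2 : R) ^- m by rewrite invr_ge0 exprn_ge0.
  have N0 : 0 <= (2 : R) ^- N by rewrite invr_ge0 exprn_ge0.
  have cm : 0 <= c * 2 ^- m by rewrite mulr_ge0.
  by rewrite mulrBr mulr1; case: ifP => _; lra.
elim: m => [|m IH].
  by rewrite /series/= big_nil expr0 invr1 subrr mulr0 add0r.
rewrite seriesSr.
have w0 : 0 <= (2 : R) ^- m.+1 by rewrite invr_ge0 exprn_ge0.
have wE : (2 : R) ^- m = 2 ^- m.+1 + 2 ^- m.+1.
  by rewrite exprS; field; rewrite expf_neq0.
have [mN|Nm] := ltnP m N.
  have t : SUprod_term x y m <= c * 2 ^- m.+1.
    by rewrite [leRHS]mulrC ler_wpM2l// dc.
  by move: IH; rewrite (ltnW mN) !mulrBr wE mulrDr; lra.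
have t : SUprod_term x y m <= 2 ^- m.+1 by rewrite ler_piMr// bm_le1.
have cw : 0 <= c * 2 ^- m.+1 by rewrite mulr_ge0.
move: IH; rewrite !mulrBr wE mulrDr; case: ifP => [mN|_]; last by lra.
have -> : N = m by apply/eqP; rewrite eqn_leq Nm mN.
by rewrite wE; lra.
Qed.

Lemma SUprod_series_cvg x y : cvgn (series (SUprod_term x y)).
Proof.
apply: nondecreasing_is_cvgn; first exact: SUprod_series_nd.
by exists (1 + 2 ^- 0) => _ [m _ <-]; apply: SUprod_series_bound.
Qed.

Lemma SUprod_dist_bound x y (N : nat) (c : R) : 0 <= c ->
  (forall n, (n < N)%N -> d n (x n) (y n) <= c) ->
  SUprod_dist x y <= c + 2 ^- N.
Proof.
move=> c0 dc; apply: limr_le; first exact: SUprod_series_cvg.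
by apply: nearW => m; exact: SUprod_series_bound.
Qed.

Lemma SUprod_term_le_dist x y n : SUprod_term x y n <= SUprod_dist x y.
Proof.
apply: (@le_trans _ _ (series (SUprod_term x y) n.+1)); last first.
  exact: (nondecreasing_cvgn_le (@SUprod_series_nd x y) (@SUprod_series_cvg x y)).
rewrite seriesSr lerDr; apply: sumr_ge0 => i _; exact: SUprod_term_ge0.
Qed.

Lemma SUprod_dist_ge0 x y : 0 <= SUprod_dist x y.
Proof. exact: le_trans (SUprod_term_ge0 x y 0) (SUprod_term_le_dist x y 0). Qed.

Lemma SUprod_distxx x : SUprod_dist x x = 0.
Proof.
rewrite /SUprod_dist (_ : series _ = fun=> 0) ?lim_cst//.
by apply/funext => n; rewrite /series/= big1// => i _; rewrite /SUprod_term bm_xx mulr0.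
Qed.

Lemma SUprod_dist_sym x y : SUprod_dist x y = SUprod_dist y x.
Proof.
congr (limn (series _)); apply/funext => n.
by rewrite /SUprod_term bm_sym.
Qed.

Lemma SUprod_dist_triangle y x z :
  SUprod_dist x z <= SUprod_dist x y + SUprod_dist y z.
Proof.
rewrite /SUprod_dist -limD; try exact: SUprod_series_cvg.
apply: ler_lim; first exact: SUprod_series_cvg.
  by apply: is_cvgD; exact: SUprod_series_cvg.
apply: nearW => m; rewrite -seriesD; apply: ler_sum => n _ /=.
by rewrite -mulrDr ler_wpM2l ?bm_triangle// invr_ge0 exprn_ge0.
Qed.

Lemma SUprod_dist_positivity x y : SUprod_dist x y = 0 -> x = y.
Proof.
move=> xy0; apply: functional_extensionality_dep => n.
apply: (@bm_positivity _ _ (d n)).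
have := SUprod_term_le_dist x y n; rewrite xy0 pmulr_rle0 ?invr_gt0 ?exprn_gt0//.
by move=> h; apply/eqP; rewrite eq_le h bm_ge0.
Qed.

Lemma SUprod_dist_le1 x y : SUprod_dist x y <= 1.
Proof.
have := @SUprod_dist_bound x y 0 0 (lexx _); rewrite expr0 invr1 add0r.
by apply.
Qed.

Lemma SUprod_nbhs x (A : set SUp) :
  nbhs x A <-> exists2 e, 0 < e & [set y | SUprod_dist x y < e] `<=` A.
Proof.
split.
- pose F : set_system SUp := filter_from [set e : R | 0 < e]
    (fun e => [set y | SUprod_dist x y < e]).
  have FF : Filter F.
    apply: filter_from_filter; first by exists 1 => /=.
    move=> e f /= e0 f0; exists (Num.min e f); first by rewrite /= lt_min e0.
    by move=> y /=; rewrite lt_min => /andP[].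
  suff : F --> (x : prod_topology (fun n => SU R n.+1)) by move=> /[apply].
  apply/cvg_sup => n B.
  rewrite (@nbhsE (initial_topology _)) => -[_ [[C oC <-] Cx]] CB.
  have /bm_nbhs : nbhs (x n) C by apply: open_nbhs_nbhs.
  move=> /(_ (d n))[e e0 eC].
  exists (2 ^- n.+1 * e) => /=; first by rewrite mulr_gt0// invr_gt0 exprn_gt0.
  move=> y /= xy; apply/CB/eC => /=.
  have := le_lt_trans (SUprod_term_le_dist x y n) xy.
  by rewrite ltr_pM2l// invr_gt0 exprn_gt0.
- move=> [e e0 eA]; apply: filterS eA _.
  have [N Ne] : exists N : nat, (2 : R) ^- N < e / 2.
    have /cvgrPdist_lt/(_ _ (divr_gt0 e0 (ltr0n _ 2)))[N _ /(_ N (leqnn N))] :=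
      @cvg_geometric R 1 2^-1 ltac:(by rewrite ger0_norm ?invf_lt1 ?ltr1n).
    rewrite /geometric/= mul1r sub0r normrN exprVn ger0_norm => [?|].
      by exists N.
    by rewrite invr_ge0 exprn_ge0.
  have e20 : 0 < e / 2 by rewrite divr_gt0.
  have H : \forall y \near (x : SUp), forall n : 'I_N, d n (x n) ((y : SUp) n) < e / 2.
    apply: (@filter_forall SUp _ (fun (n : 'I_N) (y : SUp) => d n (x n) (y n) < e / 2) (nbhs (x : SUp)) (nbhs_filter _)) => n.
    have := @proj_continuous nat (fun n => SU R n.+1) n x.
    move=> /(_ [set u | d n (x n) u < e / 2]); apply.
    by apply/(bm_nbhs (d n)); exists (e / 2).
  apply: filterS H => y Hy /=.
  have /le_lt_trans : SUprod_dist x y <= e / 2 + 2 ^- N.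
    apply: SUprod_dist_bound; first exact: ltW.
    by move=> n nN; exact: ltW (Hy (Ordinal nN)).
  by apply; rewrite [ltRHS]splitr ltrD2l.
Qed.

Let dball x (e : R) : set SUp := [set y | SUprod_dist x y < e].
Let dball_center x e : 0 < e -> dball x e x.
Proof. by rewrite /dball/= SUprod_distxx. Qed.
Let dball_sym x y e : dball x e y -> dball y e x.
Proof. by rewrite /dball/= SUprod_dist_sym. Qed.
Let dball_triangle x y z e1 e2 :
  dball x e1 y -> dball y e2 z -> dball x (e1 + e2) z.
Proof.
rewrite /dball/= => ? ?.
by rewrite (le_lt_trans (SUprod_dist_triangle y _ _))// ltrD.
Qed.
Let dball_nbhs : nbhs = nbhs_ (entourage_ dball) :> (SUp -> _).
Proof.
apply/funext => x; apply/seteqP; split => A.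
  move=> /SUprod_nbhs[e e0 eA].
  exists [set xy | dball xy.1 e xy.2]; first by exists e.
  by move=> y /xsectionP; exact: eA.
move=> [B [e e0 eB] BA]; apply/SUprod_nbhs; exists e => // y xy.
by apply/BA/xsectionP/eB.
Qed.

Let dent : set_system (SUp * SUp) := entourage_ dball.
Let dent_filter : Filter dent.
Proof.
apply: filter_from_filter; first by exists 1 => /=.
move=> e f /= e0 f0; exists (Num.min e f); first by rewrite /= lt_min e0.
by move=> xy /=; rewrite /dball/= lt_min => /andP[].
Qed.
Let dent_diagonal A : dent A -> diagonal `<=` A.
Proof.
by move=> [e e0 eA] [x y] /diagonalP ->; apply: eA; exact: dball_center.
Qed.
Let dent_inv A : dent A -> dent A^-1%relation.
Proof.
by move=> [e e0 eA]; exists e => // xy xye; apply: eA; exact: dball_sym.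
Qed.
Let dent_split A : dent A -> exists2 B, dent B & (B \; B `<=` A)%relation.
Proof.
move=> [e e0 eA]; exists [set xy | dball xy.1 (e / 2) xy.2].
  by exists (e / 2) => //=; rewrite divr_gt0.
move=> xy [z xz zy]; apply: eA => /=.
by rewrite [e]splitr; exact: dball_triangle xz zy.
Qed.

HB.instance Definition _ := @Nbhs_isUniform_mixin.Build SUp
  dent dent_filter dent_diagonal dent_inv dent_split dball_nbhs.
HB.instance Definition _ := @Uniform_isPseudoMetric.Build R SUp
  dball dball_center dball_sym dball_triangle erefl.
HB.instance Definition _ := @PseudoMetric_isMetric.Build R SUp
  SUprod_dist SUprod_dist_ge0 SUprod_dist_positivity (fun _ _ => erefl).

End Product.

Section Hausdorff.
Variables (R : realType) (M : metricType R).
Implicit Types (x y : M) (A B C : set M).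

Definition dist_to_set x B : R := inf [set mdist x y | y in B].

Definition hausdorff_dist A B : R :=
  Num.max (sup [set dist_to_set x B | x in A])
          (sup [set dist_to_set y A | y in B]).

Lemma dist_to_set_le x y B : B y -> dist_to_set x B <= mdist x y.
Proof.
by move=> By; apply: ge_inf; [exists 0 => _ [z _ <-]; exact: mdist_ge0|exists y].
Qed.

Lemma dist_to_set_ge0 x B : B !=set0 -> 0 <= dist_to_set x B.
Proof.
move=> [y By]; apply: lb_le_inf; first by exists (mdist x y), y.
by move=> _ [z _ <-]; exact: mdist_ge0.
Qed.

Lemma dist_to_set_in x B : B x -> dist_to_set x B = 0.
Proof.
move=> Bx; apply/eqP; rewrite eq_le dist_to_set_ge0 ?andbT; last by exists x.
by rewrite (le_trans (dist_to_set_le x Bx))// mdistxx.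
Qed.

Lemma hausdorff_distC A B : hausdorff_dist A B = hausdorff_dist B A.
Proof. exact: maxC. Qed.

Lemma hausdorff_distxx A : hausdorff_dist A A = 0.
Proof.
rewrite /hausdorff_dist maxxx; have [->|/set0P A0] := eqVneq A set0.
  by rewrite image_set0 sup0.
rewrite (_ : _ @` A = [set 0]) ?sup1//; apply/seteqP; split => [_ [x Ax <-]|_ ->].
  exact: dist_to_set_in.
by have [x Ax] := A0; exists x => //; exact: dist_to_set_in.
Qed.

Hypothesis mdist_le1 : forall x y, mdist x y <= 1.

Lemma dist_to_set_hausdorff x A B : B !=set0 -> A x ->
  dist_to_set x B <= hausdorff_dist A B.
Proof.
move=> [y By] Ax; rewrite le_max; apply/orP; left.
apply: ub_le_sup; last by exists x.
by exists 1 => _ [z _ <-]; rewrite (le_trans (dist_to_set_le z By)).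
Qed.

Lemma dist_to_set_triangle x A B : A !=set0 -> B !=set0 ->
  dist_to_set x B <= dist_to_set x A + hausdorff_dist A B.
Proof.
move=> [a Aa] B0; rewrite -lerBlDr; apply: lb_le_inf.
  by exists (mdist x a), a.
move=> _ [y Ay <-]; rewrite lerBlDr.
apply: (@le_trans _ _ (mdist x y + dist_to_set y B)); last first.
  by rewrite lerD2l dist_to_set_hausdorff.
rewrite -lerBlDl; have [b Bb] := B0; apply: lb_le_inf.
  by exists (mdist y b), b.
move=> _ [z Bz <-]; rewrite lerBlDl.
exact: le_trans (dist_to_set_le x Bz) (metric_triangle _ _ _).
Qed.

Lemma hausdorff_dist_triangle B A C : A !=set0 -> B !=set0 -> C !=set0 ->
  hausdorff_dist A C <= hausdorff_dist A B + hausdorff_dist B C.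
Proof.
suff half A' C' : A' !=set0 -> B !=set0 -> C' !=set0 ->
    sup [set dist_to_set x C' | x in A'] <=
    hausdorff_dist A' B + hausdorff_dist B C'.
  move=> A0 B0 C0; rewrite {1}/hausdorff_dist ge_max half//=.
  by rewrite addrC (hausdorff_distC A) (hausdorff_distC B C) half.
move=> [a Aa] B0 C0; apply: ge_sup; first by exists (dist_to_set a C'), a.
move=> _ [x Ax <-]; rewrite (le_trans (@dist_to_set_triangle x B C' B0 C0))//.
by rewrite lerD2r dist_to_set_hausdorff.
Qed.

Lemma dist_to_set_eq0 x B :
  B !=set0 -> compact B -> dist_to_set x B = 0 -> B x.
Proof.
move=> [b Bb] cB xB.
pose F : set_system M := filter_from [set e : R | 0 < e]
  (fun e => B `&` [set y | mdist x y < e]).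
have FF : ProperFilter F.
  apply: filter_from_proper; last first.
    move=> e /= e0.
    have [|_ [y By <-]] := @inf_adherent R [set mdist x y | y in B] e e0.
      split; first by exists (mdist x b), b.
      by exists 0 => _ [z _ <-]; exact: mdist_ge0.
    by rewrite -/(dist_to_set x B) xB add0r => xy; exists y.
  apply: filter_from_filter; first by exists 1 => /=.
  move=> e f /= e0 f0; exists (Num.min e f); first by rewrite /= lt_min e0.
  by move=> y /= [By]; rewrite lt_min => /andP[].
have [|p [Bp Fp]] := cB F FF; first by exists 1 => //= y [].
suff -> : x = p by [].
apply: mdist_positivity; apply/eqP; rewrite eq_le mdist_ge0 andbT.
apply/ler_addgt0Pl => e e0; rewrite addr0.
have e20 : 0 < e / 2 by rewrite divr_gt0.
have Fe : F (B `&` [set y | mdist x y < e / 2]) by exists (e / 2).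
have [y [[_ /= xy]]] := Fp _ _ Fe (nbhsx_ballx p _ e20).
rewrite ballEmdist/= metric_sym => yp.
rewrite (le_trans (metric_triangle x y p))// [leRHS]splitr.
by rewrite lerD// ltW.
Qed.

Lemma hausdorff_dist_positivity A B : A !=set0 -> B !=set0 ->
  compact A -> compact B -> hausdorff_dist A B = 0 -> A = B.
Proof.
suff half A' B' : B' !=set0 -> compact B' ->
    hausdorff_dist A' B' = 0 -> A' `<=` B'.
  move=> A0 B0 cA cB AB; apply/seteqP; split; apply: half => //.
  by rewrite hausdorff_distC.
move=> B0 cB AB x Ax; apply: dist_to_set_eq0 => //.
apply/eqP; rewrite eq_le dist_to_set_ge0// andbT -AB.
exact: dist_to_set_hausdorff.
Qed.

End Hausdorff.

Section CompactSubgroups.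
Variables (R : realType) (d : forall n, biinvariant_metric R n.+1).
Local Notation SUp := (SUprod d).

Record compact_subgroup := CompactSubgroup {
  subgroup_set :> set SUp ;
  subgroup_neq0 : subgroup_set !=set0 ;
  subgroup_mul : forall x y,
    subgroup_set x -> subgroup_set y -> subgroup_set (x * y)%g ;
  subgroup_inv : forall x, subgroup_set x -> subgroup_set x^-1%g ;
  subgroup_compact : compact subgroup_set
}.

HB.instance Definition _ := gen_eqMixin compact_subgroup.
HB.instance Definition _ := gen_choiceMixin compact_subgroup.

Implicit Types G H K : compact_subgroup.

Definition subgroup_dist G H : R := hausdorff_dist G H.

Lemma subgroup_distxx G : subgroup_dist G G = 0.
Proof. exact: hausdorff_distxx. Qed.

Lemma subgroup_dist_positivity G H : subgroup_dist G H = 0 -> G = H.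
Proof.
move=> GH; have : subgroup_set G = subgroup_set H.
  apply: hausdorff_dist_positivity GH; try exact: subgroup_neq0;
    try exact: subgroup_compact.
  exact: SUprod_dist_le1.
case: G H {GH} => [G G1 G2 G3 G4] [H H1 H2 H3 H4] /= GH.
rewrite {}GH in G1 G2 G3 G4 *.
by congr CompactSubgroup; exact: Prop_irrelevance.
Qed.

Lemma subgroup_dist_sym G H : subgroup_dist G H = subgroup_dist H G.
Proof. exact: hausdorff_distC. Qed.

Lemma subgroup_dist_triangle H G K :
  subgroup_dist G K <= subgroup_dist G H + subgroup_dist H K.
Proof.
apply: hausdorff_dist_triangle; try exact: subgroup_neq0.
exact: SUprod_dist_le1.
Qed.

HB.instance Definition _ := @isMetric.Build R compact_subgroup subgroup_dist
  subgroup_distxx subgroup_dist_positivity subgroup_dist_sym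
  subgroup_dist_triangle.

End CompactSubgroups.

Definition comeager (T : topologicalType) (A : set T) :=
  exists2 U : (set T)^nat,
    forall k, open (U k) /\ dense (U k) & \bigcap_k U k `<=` A.

Definition has_finite_order (T : groupType) (g : T) :=
  exists2 k : nat, (0 < k)%N & (g ^+ k = 1)%g.

(* Main.v *)
Require Import Defs.
From HB Require Import structures.
From mathcomp Require Import all_boot all_order fingroup perm all_algebra complex.
From mathcomp Require Import all_classical all_reals all_analysis.
From mathcomp Require Import ring lra.

(* Let p_N be the projection to the first N factors.  For every compact subgroup
   G and every N, the group p_N(G) x SU(N+1) x 1 is within 2^-N of G, so it is
   enough to see what is forced by being close to such a group H.

   Elements of infinite order: every element of H becomes, after an arbitrarily
   small change in the factor SU(N+1), one with g^k <> 1, and this persists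
   near H.  Hence in a generic G each open set {g | g^k <> 1} is dense, and
   the Baire argument in the compact group G gives g with g^k <> 1 for all k.

   Elements of finite order: if G is close enough to H, its projection J to
   SU(n), n = N+1, is so dense that it contains a neighbourhood of 1.  Indeed a
   nonzero direction tangent to J exists by Jordan's commutator argument, J
   acts on it by conjugation, and a direction normal to J would be orthogonal to
   the whole orbit; but no SU(n)-orbit of a nonzero element of su(n) is
   orthogonal to a nonzero element, and J is dense enough.  Fix finitely many
   factors, and let K be the kernel of G -> SU(n) there.  An element of G
   near 1 can be multiplied by an element of K so as to commute with K (maximise
   the real part of the trace on its coset).  So roots of suitable elements,
   hence elements x and y over the square roots of the quaternions i and j of
   a copy of SU(2), lift to the centralizer of K.  There
   z = [x^2, y^2] lies over -1 of SU(2), and an element of the centralizer over 1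
   is central, which forces z^2 = 1.  Compactness removes the restriction to
   finitely many factors. *)

Set Implicit Arguments.
Unset Strict Implicit.
Unset Printing Implicit Defensive.

Import Order.TTheory GRing.Theory Num.Theory.
Import numFieldTopology.Exports numFieldNormedType.Exports.

Local Open Scope classical_set_scope.
Local Open Scope ring_scope.
Local Open Scope sesquilinear_scope.

(** * Frobenius norm of complex matrices *)

Section ComplexParts.
Variable R : realType.
Local Notation C := (Cplx R).

Definition cre (z : C) : R := complex.Re (z : R[i]).
Definition cim (z : C) : R := complex.Im (z : R[i]).
Definition rc (r : R) : C := Complex r 0.
Definition csq (z : C) : R := cre z ^+ 2 + cim z ^+ 2.

Lemma creD z w : cre (z + w) = cre z + cre w.
Proof. by case: z => a b; case: w. Qed.
Lemma creN z : cre (- z) = - cre z.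
Proof. by case: z. Qed.
Lemma cre0 : cre 0 = 0. Proof. by []. Qed.
Lemma cre_sum I (r : seq I) (P : pred I) (F : I -> C) :
  cre (\sum_(i <- r | P i) F i) = \sum_(i <- r | P i) cre (F i).
Proof. exact: (big_morph cre creD cre0). Qed.
Lemma cre_conj z : cre z^* = cre z.
Proof. by case: z. Qed.
Lemma creM z w : cre (z * w) = cre z * cre w - cim z * cim w.
Proof. by case: z => a b; case: w. Qed.
Lemma cim_conj z : cim z^* = - cim z.
Proof. by case: z. Qed.
Lemma creZ r z : cre (rc r * z) = r * cre z.
Proof. by rewrite creM /= mul0r subr0. Qed.
Lemma cre_rc r : cre (rc r) = r. Proof. by []. Qed.
Lemma rcM r s : rc (r * s) = rc r * rc s.
Proof. by apply/eqP; rewrite eq_complex /= !mulr0 !mul0r subr0 addr0 !eqxx. Qed.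
Lemma rcD r s : rc (r + s) = rc r + rc s.
Proof. by apply/eqP; rewrite eq_complex /= addr0 !eqxx. Qed.
Lemma rcN r : rc (- r) = - rc r.
Proof. by apply/eqP; rewrite eq_complex /= oppr0 !eqxx. Qed.
Lemma rc1 : rc 1 = 1. Proof. by []. Qed.
Lemma rc_nat n : rc n%:R = n%:R.
Proof. by elim: n => [|n IH]; rewrite ?mulr0n// !mulrS rcD IH. Qed.
Lemma rc_conj r : (rc r)^* = rc r.
Proof. by apply/eqP; rewrite eq_complex /= oppr0 !eqxx. Qed.
Lemma cre_mulC z : cre (z * z^*) = csq z.
Proof. by rewrite creM cre_conj cim_conj /csq; ring. Qed.
Lemma csq_ge0 z : 0 <= csq z.
Proof. by rewrite addr_ge0// sqr_ge0. Qed.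
Lemma csq_eq0 z : csq z = 0 -> z = 0.
Proof.
move/eqP; rewrite paddr_eq0 ?sqr_ge0// !sqrf_eq0 => /andP[/eqP a /eqP b].
by apply/eqP; rewrite eq_complex /=; apply/andP; split; apply/eqP.
Qed.
Lemma mul_conj_csq z : z * z^* = rc (csq z).
Proof.
by case: z => a b; apply/eqP; rewrite eq_complex /csq /=; apply/andP; split; apply/eqP;
  rewrite /=; ring.
Qed.
End ComplexParts.

(** The real part of the Hermitian Frobenius form: matrices are treated as a real Euclidean space,
    which is the geometry in which tangent and normal directions are compared. *)
HB.lock Definition ip (R : realType) m n (A B : 'M[Cplx R]_(m, n)) : R :=
  cre (\tr (A *m B^t*)).
HB.lock Definition nsq (R : realType) m n (A : 'M[Cplx R]_(m, n)) : R := ip A A.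
HB.lock Definition nrm (R : realType) m n (A : 'M[Cplx R]_(m, n)) : R :=
  Num.sqrt (nsq A).
HB.lock Definition rtr (R : realType) n (A : 'M[Cplx R]_n) : R := cre (\tr A).

Section Frobenius.
Variable R : realType.
Local Notation C := (Cplx R).

Section Rect.
Variables m n : nat.
Implicit Types A B D : 'M[C]_(m, n).

Lemma ipE A B : ip A B = \sum_i \sum_j cre (A i j * (B i j)^*).
Proof.
rewrite ip.unlock /mxtrace cre_sum; apply: eq_bigr => i _.
by rewrite !mxE cre_sum; apply: eq_bigr => j _; rewrite !mxE.
Qed.

Lemma nsqE A : nsq A = \sum_i \sum_j csq (A i j).
Proof. by rewrite nsq.unlock ipE; do 2!apply: eq_bigr => ? _; rewrite cre_mulC. Qed.

Lemma ipDl A B D : ip (A + B) D = ip A D + ip B D.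
Proof. by rewrite ip.unlock mulmxDl mxtraceD creD. Qed.
Lemma ipNl A D : ip (- A) D = - ip A D.
Proof. by rewrite ip.unlock mulNmx raddfN /= creN. Qed.
Lemma ipBl A B D : ip (A - B) D = ip A D - ip B D.
Proof. by rewrite ipDl ipNl. Qed.
Lemma ipZl r A D : ip (rc r *: A) D = r * ip A D.
Proof. by rewrite ip.unlock -scalemxAl mxtraceZ creZ. Qed.
Lemma ipC A B : ip A B = ip B A.
Proof.
rewrite !ipE; do 2!apply: eq_bigr => ? _.
by rewrite -[LHS]cre_conj rmorphM /= conjCK mulrC.
Qed.
Lemma ipDr A B D : ip D (A + B) = ip D A + ip D B.
Proof. by rewrite !(ipC D) ipDl. Qed.
Lemma ipNr A D : ip D (- A) = - ip D A.
Proof. by rewrite !(ipC D) ipNl. Qed.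
Lemma ipBr A B D : ip D (A - B) = ip D A - ip D B.
Proof. by rewrite !(ipC D) ipBl. Qed.
Lemma ipZr r A D : ip D (rc r *: A) = r * ip D A.
Proof. by rewrite !(ipC D) ipZl. Qed.

Lemma nsqI A : nsq A = ip A A. Proof. by rewrite nsq.unlock. Qed.
Lemma nrmE A : nrm A = Num.sqrt (nsq A). Proof. by rewrite nrm.unlock. Qed.

Lemma nsq_ge0 A : 0 <= nsq A.
Proof. by rewrite nsqE; do 2!apply: sumr_ge0 => ? _; exact: csq_ge0. Qed.
Lemma nrm_ge0 A : 0 <= nrm A. Proof. by rewrite nrm.unlock sqrtr_ge0. Qed.
Lemma nrm_sq A : nrm A ^+ 2 = nsq A.
Proof. by rewrite nrm.unlock sqr_sqrtr ?nsq_ge0. Qed.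

Lemma csq_le_nsq A i j : csq (A i j) <= nsq A.
Proof.
rewrite nsqE (bigD1 i)//= (bigD1 j)//= -addrA lerDl addr_ge0//.
  by apply: sumr_ge0 => ? _; exact: csq_ge0.
by do 2!apply: sumr_ge0 => ? _; exact: csq_ge0.
Qed.

Lemma nrm_eq0 A : nrm A = 0 -> A = 0.
Proof.
move=> A0; apply/matrixP => i j; rewrite mxE; apply: csq_eq0.
by apply/eqP; rewrite eq_le csq_ge0 andbT (le_trans (csq_le_nsq A i j))// -nrm_sq A0 expr0n.
Qed.

Lemma nrm0 : nrm (0 : 'M[C]_(m, n)) = 0.
Proof. by rewrite nrm.unlock nsq.unlock ip.unlock mul0mx linear0 /= sqrtr0. Qed.

Lemma nrm_gt0 A : A != 0 -> 0 < nrm A.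
Proof.
by move=> A0; rewrite lt_neqAle nrm_ge0 andbT eq_sym; apply: contraNneq A0 => /nrm_eq0/eqP.
Qed.

Lemma nrmN A : nrm (- A) = nrm A.
Proof. by rewrite nrm.unlock nsq.unlock ipNl ipNr opprK. Qed.
Lemma nrmBC A B : nrm (A - B) = nrm (B - A).
Proof. by rewrite -nrmN opprB. Qed.
Lemma nrmZ r A : nrm (rc r *: A) = `|r| * nrm A.
Proof.
rewrite nrm.unlock nsq.unlock ipZl ipZr mulrA -expr2 sqrtrM ?sqr_ge0// sqrtr_sqr//.
Qed.

Lemma nsqD A B : nsq (A + B) = nsq A + 2 * ip A B + nsq B.
Proof. by rewrite nsq.unlock ipDl !ipDr (ipC B A); ring. Qed.
Lemma nsqB A B : nsq (A - B) = nsq A - 2 * ip A B + nsq B.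
Proof. by rewrite nsq.unlock ipBl !ipBr (ipC B A); ring. Qed.

Lemma ip_le A B : ip A B <= nrm A * nrm B.
Proof.
have [/nrm_eq0 ->|A0] := eqVneq (nrm A) 0.
  by rewrite nrm0 mul0r ip.unlock mul0mx linear0.
have [/nrm_eq0 ->|B0] := eqVneq (nrm B) 0.
  by rewrite nrm0 mulr0 ipC ip.unlock mul0mx linear0.
have a0 : 0 < nrm A by rewrite lt_neqAle eq_sym A0 nrm_ge0.
have b0 : 0 < nrm B by rewrite lt_neqAle eq_sym B0 nrm_ge0.
(* Cauchy-Schwarz: the square expands to [2 * nrm A * nrm B * (nrm A * nrm B - ip A B)]. *)
have := nsq_ge0 (rc (nrm B) *: A - rc (nrm A) *: B).
rewrite nsqB !nsqI !(ipZl, ipZr) -!nsqI -!nrm_sq => h.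
have ab : 0 < nrm A * nrm B by rewrite mulr_gt0.
rewrite -subr_ge0 -(pmulr_rge0 _ ab).
set a := nrm A in h *; set b := nrm B in h *; set c := ip A B in h *.
by nra.
Qed.

Lemma norm_ip_le A B : `|ip A B| <= nrm A * nrm B.
Proof.
by rewrite ler_norml ip_le andbT lerNl -ipNl -(nrmN A) ip_le.
Qed.

Lemma nrmD A B : nrm (A + B) <= nrm A + nrm B.
Proof.
rewrite -(ler_pXn2r (ltn0Sn 1)) ?nnegrE ?addr_ge0 ?nrm_ge0//.
rewrite nrm_sq nsqD -!nrm_sq; have := ip_le A B; lra.
Qed.
Lemma nrmB A B : nrm (A - B) <= nrm A + nrm B.
Proof. by rewrite -(nrmN B) nrmD. Qed.
Lemma nrm_trans B A D : nrm (A - D) <= nrm (A - B) + nrm (B - D).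
Proof. by rewrite (le_trans _ (nrmD _ _))// addrA subrK. Qed.
Lemma nrm_dist A B : `|nrm A - nrm B| <= nrm (A - B).
Proof.
rewrite ler_norml; apply/andP; split.
  by have := nrmD (B - A) A; rewrite subrK nrmBC; lra.
by have := nrmD (A - B) B; rewrite subrK; lra.
Qed.
End Rect.

Lemma nrm_adj m n (A : 'M[C]_(m, n)) : nrm (A^t*) = nrm A.
Proof. by rewrite nrm.unlock nsq.unlock ip.unlock trmxCK mxtrace_mulC. Qed.

Lemma trmxC_mul m n p (A : 'M[C]_(m, n)) (B : 'M[C]_(n, p)) :
  (A *m B)^t* = B^t* *m A^t*.
Proof. by rewrite trmx_mul map_mxM. Qed.

Lemma trmxC_add m n (A B : 'M[C]_(m, n)) : (A + B)^t* = A^t* + B^t*.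
Proof. by rewrite linearD /= map_mxD. Qed.
Lemma trmxC_opp m n (A : 'M[C]_(m, n)) : (- A)^t* = - A^t*.
Proof. by rewrite linearN /= map_mxN. Qed.
Lemma trmxC_scale m n r (A : 'M[C]_(m, n)) : (rc r *: A)^t* = rc r *: A^t*.
Proof. by apply/matrixP => i j; rewrite !mxE rmorphM /= rc_conj. Qed.
Lemma trmxC1 n : (1%:M : 'M[C]_n)^t* = 1%:M.
Proof. by rewrite trmx1 map_mx1. Qed.

(** The complex Cauchy-Schwarz inequality follows from the real one: multiplying [A] by the
    conjugate of [z] makes the product equal to the real number [csq z]. *)
Lemma csq_mul_le n (A : 'M[C]_(1, n)) (B : 'M[C]_(n, 1)) :
  csq ((A *m B) 0 0) <= nsq A * nsq B.
Proof.
set z := (A *m B) 0 0.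
have tr1 (D : 'M[C]_1) : \tr D = D 0 0 by rewrite /mxtrace big_ord1.
have e : ip (z^* *: A) (B^t*) = csq z.
  by rewrite ip.unlock trmxCK -scalemxAl mxtraceZ tr1 -/z mulrC cre_mulC.
have nz : nsq (z^* *: A) = csq z * nsq A.
  rewrite !nsqE mulr_sumr; apply: eq_bigr => i _.
  rewrite mulr_sumr; apply: eq_bigr => j _; rewrite mxE.
  by case: z (A i j) {e} => a b [u v]; rewrite /csq /=; ring.
have := ip_le (z^* *: A) (B^t*).
rewrite e nrm_adj nrmE nz sqrtrM ?csq_ge0// -nrmE.
have [->|z0] := eqVneq (csq z) 0; first by move=> _; rewrite mulr_ge0 ?nsq_ge0.
have zp : 0 < csq z by rewrite lt_neqAle eq_sym z0 csq_ge0.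
rewrite -[X in X <= _ -> _](sqr_sqrtr (csq_ge0 z)) expr2 -mulrA ler_pM2l ?sqrtr_gt0// => h.
rewrite -(sqr_sqrtr (csq_ge0 z)) -!nrm_sq -exprMn.
by rewrite lerXn2r ?nnegrE ?mulr_ge0 ?nrm_ge0 ?sqrtr_ge0.
Qed.

Lemma nrmM m n p (A : 'M[C]_(m, n)) (B : 'M[C]_(n, p)) :
  nrm (A *m B) <= nrm A * nrm B.
Proof.
rewrite -(ler_pXn2r (ltn0Sn 1)) ?nnegrE ?mulr_ge0 ?nrm_ge0//.
rewrite exprMn !nrm_sq nsqE.
have -> : nsq A = \sum_i nsq (row i A).
  by rewrite nsqE; apply: eq_bigr => i _; rewrite nsqE big_ord1; apply: eq_bigr => j _; rewrite mxE.
have -> : nsq B = \sum_j nsq (col j B).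
  rewrite nsqE exchange_big; apply: eq_bigr => i _; rewrite nsqE.
  by apply: eq_bigr => j _; rewrite big_ord1 mxE.
rewrite mulr_suml; apply: ler_sum => i _; rewrite mulr_sumr; apply: ler_sum => j _.
apply: le_trans (csq_mul_le _ _); rewrite le_eqVlt; apply/orP; left; apply/eqP; congr csq.
by rewrite !mxE; apply: eq_bigr => k _; rewrite !mxE.
Qed.

Section Square.
Variable n : nat.
Implicit Types A B U : 'M[C]_n.

Lemma rtrD A B : rtr (A + B) = rtr A + rtr B.
Proof. by rewrite rtr.unlock mxtraceD creD. Qed.
Lemma rtrN A : rtr (- A) = - rtr A.
Proof. by rewrite rtr.unlock raddfN /= creN. Qed.
Lemma rtrB A B : rtr (A - B) = rtr A - rtr B.
Proof. by rewrite rtrD rtrN. Qed.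
Lemma rtrZ r A : rtr (rc r *: A) = r * rtr A.
Proof. by rewrite rtr.unlock mxtraceZ creZ. Qed.
Lemma rtrC A B : rtr (A *m B) = rtr (B *m A).
Proof. by rewrite rtr.unlock mxtrace_mulC. Qed.
Lemma rtr_adj A : rtr (A^t*) = rtr A.
Proof. by rewrite rtr.unlock -map_trmx mxtrace_tr trace_map_mx cre_conj. Qed.
Lemma rtrM_le A B : `|rtr (A *m B)| <= nrm A * nrm B.
Proof. by have := norm_ip_le A (B^t*); rewrite ip.unlock rtr.unlock trmxCK nrm_adj. Qed.
Lemma rtr_sq A : rtr (A *m A^t*) = nsq A.
Proof. by rewrite rtr.unlock nsq.unlock ip.unlock. Qed.

Lemma unit_mulV U : U \is unitarymx -> U *m U^t* = 1%:M.
Proof. by move/unitarymxP. Qed.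
Lemma unit_Vmul U : U \is unitarymx -> U^t* *m U = 1%:M.
Proof. by move=> uU; apply: mulmx1C; exact: unit_mulV. Qed.

Lemma nrmUl U A : U \is unitarymx -> nrm (U *m A) = nrm A.
Proof.
move=> uU; rewrite nrm.unlock nsq.unlock ip.unlock trmxC_mul mxtrace_mulC.
by rewrite mulmxA -(mulmxA (A^t*)) unit_Vmul// mulmx1 mxtrace_mulC.
Qed.
Lemma nrmUr U A : U \is unitarymx -> nrm (A *m U) = nrm A.
Proof.
by move=> uU; rewrite nrm.unlock nsq.unlock ip.unlock trmxC_mul mulmxA -(mulmxA A) unit_mulV// mulmx1.
Qed.

Lemma nsq1 : nsq (1%:M : 'M[C]_n) = n%:R.
Proof. by rewrite nsq.unlock ip.unlock mul1mx trmxC1 mxtrace1 -rc_nat. Qed.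

Lemma nsq_unitary U : U \is unitarymx -> nsq U = n%:R.
Proof. by move=> uU; rewrite -nrm_sq -[U]mulmx1 nrmUl// nrm_sq nsq1. Qed.

(** All unitary matrices have the same norm, so approaching 1 amounts to increasing the real trace.
    Closest points can thus be found by maximising a linear function. *)
Lemma nsq_unit1 U : U \is unitarymx -> nsq (U - 1%:M) = 2 * (n%:R - rtr U).
Proof.
move=> uU; rewrite nsqB nsq_unitary// nsq1.
have -> : ip U 1%:M = rtr U by rewrite ip.unlock trmxC1 mulmx1 rtr.unlock.
by move: (rtr U) => r; ring.
Qed.

(** The commutator contraction behind Jordan's theorem: [U V - V U] does not change when 1 is
    subtracted from both [U] and [V]. *)
Lemma nrm_comm U V : U \is unitarymx -> V \is unitarymx ->
  nrm (U *m V *m U^t* *m V^t* - 1%:M) <= 2 * nrm (U - 1%:M) * nrm (V - 1%:M).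
Proof.
move=> uU uV.
have -> : U *m V *m U^t* *m V^t* - 1%:M =
   ((U - 1%:M) *m (V - 1%:M) - (V - 1%:M) *m (U - 1%:M)) *m (U^t* *m V^t*).
  have -> : (U - 1%:M) *m (V - 1%:M) - (V - 1%:M) *m (U - 1%:M) = U *m V - V *m U.
    rewrite !mulmxBl !mulmxBr !mul1mx !mulmx1.
    rewrite !opprB !addrA; apply/matrixP => i j; rewrite !mxE; ring.
  rewrite mulmxBl !mulmxA; congr (_ - _).
  by rewrite -(mulmxA V U) unit_mulV// mulmx1 unit_mulV.
rewrite mulmxA !nrmUr ?trmxC_unitary//.
apply: le_trans (nrmB _ _) _.
apply: le_trans (lerD (nrmM _ _) (nrmM _ _)) _; lra.
Qed.

Lemma nrm_pow U k : U \is unitarymx ->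
  U ^+ k \is unitarymx /\ nrm (U ^+ k - 1%:M) <= k%:R * nrm (U - 1%:M).
Proof.
move=> uU; elim: k => [|k [uk IH]].
  rewrite expr0 subrr nrm0 mul0r; split; last exact: lexx.
  by apply/unitarymxP; rewrite mul1mx trmxC1.
rewrite exprS; split; first exact: mul_unitarymx.
have -> : U * U ^+ k - 1%:M = U *m (U ^+ k - 1%:M) + (U - 1%:M).
  by rewrite mulmxBr mulmx1 addrA subrK.
rewrite (le_trans (nrmD _ _))// nrmUl// mulrS; lra.
Qed.

(** Powers are linear to first order near 1; the error at step [k] gains [(U ^+ k - 1) (U - 1)],
    which is of second order. *)
Lemma nrm_pow2 U k : U \is unitarymx ->
  nrm (U ^+ k - 1%:M - rc k%:R *: (U - 1%:M)) <= (k%:R * nrm (U - 1%:M)) ^+ 2.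
Proof.
move=> uU; elim: k => [|k IH].
  by rewrite expr0 subrr mulr0n scale0r subr0 nrm0 mul0r expr0n.
have [uk kb] := nrm_pow k uU.
have -> : U ^+ k.+1 - 1%:M - rc k.+1%:R *: (U - 1%:M) =
   (U ^+ k - 1%:M - rc k%:R *: (U - 1%:M)) + (U ^+ k - 1%:M) *m (U - 1%:M).
  rewrite -addn1 natrD rcD rc1 scalerDl scale1r addn1 exprSr.
  rewrite mulmxBl !mulmxBr !mul1mx !mulmx1 -[U ^+ k * U]/(U ^+ k *m U).
  by apply/matrixP => i j; rewrite !mxE; ring.
apply: le_trans (nrmD _ _) _; apply: le_trans (lerD IH (nrmM _ _)) _.
have := nrm_ge0 (U - 1%:M); set s := nrm (U - 1%:M) in kb * => s0.
apply: (le_trans (lerD (lexx _) (ler_wpM2r s0 kb))).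
have k0 : 0 <= k%:R :> R by [].
rewrite -natr1; nra.
Qed.
End Square.
End Frobenius.

(** * Sequences and limits of matrices *)

Section Sequences.
Variable R : realType.

Definition subsequence (phi : nat -> nat) := forall i, (phi i < phi i.+1)%N.

Lemma subsequence_ge phi : subsequence phi -> forall i, (i <= phi i)%N.
Proof. by move=> h; elim=> // i IH; exact: leq_ltn_trans IH (h i). Qed.

Lemma subsequence_homo phi : subsequence phi ->
  forall i j, (i < j)%N -> (phi i < phi j)%N.
Proof.
by move=> h; apply: (@homo_ltn _ phi (fun a b => (a < b)%N)) => // a b c; exact: ltn_trans.
Qed.

Lemma subsequence_comp phi psi :
  subsequence phi -> subsequence psi -> subsequence (phi \o psi).
Proof. by move=> h k i; exact: subsequence_homo h _ _ (k i). Qed.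

Lemma subsequence_cvg phi : subsequence phi -> phi @ \oo --> \oo.
Proof.
move=> h A [N _ NA]; exists N => // i /= Ni; apply: NA => /=.
exact: leq_trans Ni (subsequence_ge h i).
Qed.

Lemma cvg_subsequence (T : topologicalType) (u : nat -> T) (p : T) phi :
  subsequence phi -> u @ \oo --> p -> (u \o phi) @ \oo --> p.
Proof. by move=> h up; apply: cvg_comp up; exact: subsequence_cvg. Qed.

Lemma invS_lt (e : R) : 0 < e -> exists N, forall i, (N <= i)%N -> i.+1%:R^-1 < e.
Proof.
by move=> e0; have [N _ H] := near_infty_natSinv_lt (PosNum e0); exists N => i; exact: H.
Qed.

Lemma cvg_invS : (fun i => i.+1%:R^-1 : R) @ \oo --> (0 : R).
Proof.
apply/cvgrPdist_lt => e /invS_lt[N HN]; exists N => // i /= Ni.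
by rewrite sub0r normrN ger0_norm// HN.
Qed.

Lemma cvg0_squeeze (u v : nat -> R) :
  (forall i, 0 <= u i <= v i) -> v @ \oo --> (0 : R) -> u @ \oo --> (0 : R).
Proof.
move=> uv v0; apply: (squeeze_cvgr _ (cvg_cst 0) v0); apply: nearW => i; exact: uv.
Qed.

Lemma cvg_sumr (I : Type) (s : seq I) (f : I -> nat -> R) (l : I -> R) :
  (forall x, f x @ \oo --> l x) ->
  (fun k => \sum_(x <- s) f x k) @ \oo --> \sum_(x <- s) l x.
Proof.
move=> fl; elim: s => [|x s IH].
  rewrite big_nil (_ : (fun k => _) = fun=> 0); first exact: cvg_cst.
  by apply/funext => k; rewrite big_nil.
rewrite big_cons (_ : (fun k => _) = fun k => f x k + \sum_(y <- s) f y k).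
  exact: cvgD.
by apply/funext => k; rewrite big_cons.
Qed.

Lemma compact_subsequence (T : pseudoMetricType R) (A : set T) (u : nat -> T) :
  compact A -> (forall i, A (u i)) ->
  exists p, A p /\ exists2 phi, subsequence phi & (u \o phi) @ \oo --> p.
Proof.
move=> cA Au; have [|p [Ap clp]] := cA (u @ \oo) _.
  by exists 0%N => // i _; exact: Au.
exists p; split=> //.
have H k N : exists i, (N <= i)%N /\ ball p k.+1%:R^-1 (u i).
  have [_ [[i Ni <-] B]] := clp (u @` [set i | (N <= i)%N]) (ball p (k.+1%:R^-1 : R))
    ltac:(by exists N => // i Ni; exists i) (nbhsx_ballx p (k.+1%:R^-1 : R) ltac:(by [])).
  by exists i.
have [f fP] := choice (fun kN : nat * nat => H kN.1 kN.2).
(* Each index is sought beyond the previous one, which makes [phi] strictly increasing. *)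
pose phi := fix phi k := if k is k'.+1 then f (k, (phi k').+1) else f (0%N, 0%N).
exists phi; first by move=> i; exact: (fP (i.+1, (phi i).+1)).1.
apply/cvg_ballP => e /invS_lt[N HN]; exists N => // i /= Ni.
apply: (le_ball (ltW (HN i Ni))).
by case: i {Ni} => [|i]; [exact: (fP (0%N, 0%N)).2|exact: (fP (i.+1, (phi i).+1)).2].
Qed.

Lemma bounded_subsequence (u : nat -> R) c : (forall i, `|u i| <= c) ->
  exists2 phi, subsequence phi & exists l : R, (u \o phi) @ \oo --> l.
Proof.
move=> uc; have [|l [_ [phi h k]]] := compact_subsequence (@segment_compact R (- c) c) (u := u).
  by move=> i; rewrite /= in_itv /= -ler_norml.
by exists phi => //; exists l.
Qed.

Lemma bounded_subsequence_seq (I : eqType) (s : seq I) (u : I -> nat -> R) c :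
  (forall x i, `|u x i| <= c) ->
  exists2 phi, subsequence phi & forall x, x \in s -> exists l : R, (u x \o phi) @ \oo --> l.
Proof.
move=> uc; elim: s => [|x s [phi h IH]]; first by exists id.
have [psi k [l cl]] := @bounded_subsequence (u x \o phi) c (fun i => uc x (phi i)).
exists (phi \o psi); first exact: subsequence_comp.
move=> y; rewrite inE => /predU1P[->|/IH[l' cl']]; first by exists l.
by exists l'; exact: cvg_subsequence cl'.
Qed.
End Sequences.

Section MatrixLimits.
Variable R : realType.
Local Notation C := (Cplx R).

Definition mcvg m n (u : nat -> 'M[C]_(m, n)) (p : 'M[C]_(m, n)) :=
  (fun i => nrm (u i - p)) @ \oo --> (0 : R).

Section Rect.
Variables m n : nat.
Implicit Types (u v : nat -> 'M[C]_(m, n)) (p q : 'M[C]_(m, n)).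

Lemma mcvg_squeeze u p (e : nat -> R) :
  (forall i, nrm (u i - p) <= e i) -> e @ \oo --> (0 : R) -> mcvg u p.
Proof. by move=> h; apply: cvg0_squeeze => i; rewrite nrm_ge0 h. Qed.

Lemma mcvg_eq u v p : u =1 v -> mcvg u p -> mcvg v p.
Proof. by move=> /funext ->. Qed.

Lemma mcvg_cst p : mcvg (fun=> p) p.
Proof. by apply: (@mcvg_squeeze _ _ (fun=> 0)) => [_|]; [rewrite subrr nrm0|exact: cvg_cst]. Qed.

Lemma mcvg_nearby u p e : mcvg u p -> 0 < e ->
  exists N, forall i, (N <= i)%N -> nrm (u i - p) < e.
Proof.
move=> /cvgrPdist_lt cu /cu[N _ HN]; exists N => i /HN /=.
by rewrite sub0r normrN ger0_norm ?nrm_ge0.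
Qed.

Lemma mcvg_sub u p phi : subsequence phi -> mcvg u p -> mcvg (u \o phi) p.
Proof. by move=> h /(cvg_subsequence h). Qed.

Lemma mcvgD u v p q : mcvg u p -> mcvg v q -> mcvg (fun i => u i + v i) (p + q).
Proof.
move=> up vq; apply: (@mcvg_squeeze _ _ (fun i => nrm (u i - p) + nrm (v i - q))) => [i|].
  by rewrite opprD addrACA nrmD.
by rewrite -[X in _ --> X](addr0 0); exact: cvgD.
Qed.

Lemma mcvgN u p : mcvg u p -> mcvg (fun i => - u i) (- p).
Proof.
move=> up; apply: (@mcvg_squeeze _ _ (fun i => nrm (u i - p))) => // i.
by rewrite -opprD nrmN.
Qed.

Lemma mcvgB u v p q : mcvg u p -> mcvg v q -> mcvg (fun i => u i - v i) (p - q).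
Proof. by move=> up /mcvgN; exact: mcvgD. Qed.

Lemma mcvg_adj u p : mcvg u p -> mcvg (fun i => (u i)^t*) (p^t*).
Proof.
move=> up; rewrite /mcvg (_ : (fun i => _) = fun i => nrm (u i - p)) //.
by apply/funext => i; rewrite -trmxC_opp -trmxC_add nrm_adj.
Qed.


Lemma mcvg_nrm u p : mcvg u p -> (fun i => nrm (u i)) @ \oo --> nrm p.
Proof.
move=> up; apply/cvgrPdist_lt => e e0.
move/cvgrPdist_lt : up => /(_ e e0); apply: filterS => i.
rewrite sub0r normrN ger0_norm ?nrm_ge0// distrC; apply: le_lt_trans.
exact: nrm_dist.
Qed.

Lemma mcvg_unique u p q : mcvg u p -> mcvg u q -> p = q.
Proof.
move=> up uq; apply/eqP; rewrite -subr_eq0; apply/eqP/nrm_eq0.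
have /mcvg_nrm h := mcvgB up uq.
apply: (cvg_unique _ h) => //.
rewrite (_ : (fun i => _) = fun=> 0); first exact: cvg_cst.
by apply/funext => i; rewrite subrr nrm0.
Qed.

(** Bolzano-Weierstrass, applied simultaneously to the finitely many real and imaginary parts of the
    entries. *)
Lemma bounded_mcvg u c : (forall i, nrm (u i) <= c) ->
  exists2 phi, subsequence phi & exists p, mcvg (u \o phi) p.
Proof.
move=> uc.
pose f (x : 'I_m * 'I_n * bool) i : R :=
  if x.2 then cre (u i x.1.1 x.1.2) else cim (u i x.1.1 x.1.2).
have fc x i : `|f x i| <= c.
  apply: le_trans (uc i); rewrite nrmE -sqrtr_sqr ler_sqrt ?nsq_ge0//.
  apply: le_trans (csq_le_nsq _ x.1.1 x.1.2).
  by rewrite /f /csq; case: x => -[k l] [] /=; rewrite ?lerDl ?lerDr sqr_ge0.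
have [phi h H] := bounded_subsequence_seq (enum {: 'I_m * 'I_n * bool}) fc.
exists phi => //.
have /choice[l lP] : forall x, exists l : R, (f x \o phi) @ \oo --> l.
  by move=> x; apply: H; rewrite mem_enum.
exists (\matrix_(i, j) (Complex (l (i, j, true)) (l (i, j, false)) : C)).
rewrite /mcvg (_ : (fun i => _) = fun k => Num.sqrt
  (\sum_i \sum_j ((f (i, j, true) (phi k) - l (i, j, true)) ^+ 2 +
                  (f (i, j, false) (phi k) - l (i, j, false)) ^+ 2))); last first.
  apply/funext => k; rewrite nrmE nsqE; congr Num.sqrt.
  apply: eq_bigr => i _; apply: eq_bigr => j _; rewrite !mxE /csq /f /=.
  by case: (u (phi k) i j).
rewrite -[X in _ --> X]sqrtr0.
apply: (continuous_cvg _ (@sqrt_continuous R 0)).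
rewrite [X in _ --> X](_ : 0 = \sum_(i < m) \sum_(j < n) (0 ^+ 2 + 0 ^+ 2)); last first.
  by rewrite big1// => i _; rewrite big1// => j _; rewrite expr0n addr0.
have cv x : (fun k => (f x (phi k) - l x) ^+ 2) @ \oo --> (0 ^+ 2 : R).
  rewrite expr2 (_ : (fun k => _) = fun k => (f x (phi k) - l x) * (f x (phi k) - l x)); last first.
    by apply/funext => k; rewrite expr2.
  have c0 : (fun k => f x (phi k) - l x) @ \oo --> (0 : R).
    by rewrite -(subrr (l x)); apply: cvgB; [exact: lP|exact: cvg_cst].
  exact: cvgM.
apply: (@cvg_sumr _ _ _ (fun i k => \sum_j ((f (i, j, true) (phi k) - l (i, j, true)) ^+ 2 +
  (f (i, j, false) (phi k) - l (i, j, false)) ^+ 2)) (fun=> _)) => i.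
apply: (@cvg_sumr _ _ _ (fun j k => (f (i, j, true) (phi k) - l (i, j, true)) ^+ 2 +
  (f (i, j, false) (phi k) - l (i, j, false)) ^+ 2) (fun=> _)) => j.
exact: cvgD.
Qed.
End Rect.

Lemma mcvgM m n p (u : nat -> 'M[C]_(m, n)) (v : nat -> 'M[C]_(n, p)) a b :
  mcvg u a -> mcvg v b -> mcvg (fun i => u i *m v i) (a *m b).
Proof.
move=> ua vb; apply: (@mcvg_squeeze _ _ _ _
  (fun i => nrm (u i - a) * nrm (v i) + nrm a * nrm (v i - b))) => [i|].
  rewrite (_ : _ - _ = (u i - a) *m v i + a *m (v i - b)).
    by rewrite (le_trans (nrmD _ _))// lerD ?nrmM.
  by rewrite mulmxBl mulmxBr addrA subrK.
rewrite -[X in _ --> X](addr0 0) -[X in _ --> X + _](mul0r (nrm b)) -[X in _ --> _ + X](mulr0 (nrm a)).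
by apply: cvgD; apply: cvgM => //; [exact: mcvg_nrm|exact: cvg_cst].
Qed.

Lemma mcvg_rtr n (u : nat -> 'M[C]_n) p : mcvg u p -> (fun i => rtr (u i)) @ \oo --> rtr p.
Proof.
move=> up; apply/cvgrPdist_lt => e e0.
have n0 : 0 < nrm (1%:M : 'M[C]_n) + 1 by rewrite ltr_wpDl ?nrm_ge0.
move/cvgrPdist_lt : up => /(_ (e / (nrm (1%:M : 'M[C]_n) + 1))).
rewrite divr_gt0// => /(_ isT); apply: filterS => i.
rewrite sub0r normrN ger0_norm ?nrm_ge0// distrC -rtrB -[_ - p]mulmx1 => h.
apply: le_lt_trans (rtrM_le _ _) _.
rewrite (ltr_pdivlMr _ _ n0) in h.
by apply: le_lt_trans h; rewrite mulmx1 ler_wpM2l ?nrm_ge0// lerDl.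
Qed.

End MatrixLimits.

(** * Compact unitary groups and their tangent directions *)

(** The unit vector pointing from 1 to [U]; at [U = 1] the convention for the inverse of 0 makes it
    0. *)
HB.lock Definition dir (R : realType) n (U : 'M[Cplx R]_n) : 'M[Cplx R]_n :=
  rc (nrm (U - 1%:M))^-1 *: (U - 1%:M).

Section UnitaryGroups.
Variables (R : realType) (n : nat).
Local Notation C := (Cplx R).
Implicit Types (K : set 'M[C]_n) (A Y U : 'M[C]_n).

Definition ugroup K :=
  [/\ forall k, K k -> k \is unitarymx, K 1%:M,
      forall k l, K k -> K l -> K (k *m l) & forall k, K k -> K (k^t*)].

Definition seqcompact K := forall u : nat -> 'M[C]_n, (forall i, K (u i)) ->
  exists p, K p /\ exists2 phi, subsequence phi & mcvg (u \o phi) p.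

Definition skewherm Y := Y^t* = - Y.

Lemma dir_def U : dir U = rc (nrm (U - 1%:M))^-1 *: (U - 1%:M).
Proof. by rewrite dir.unlock. Qed.

(* [tangent K Y] : Y belongs to the tangent cone of K at 1. *)
Definition tangent K Y := forall e, 0 < e -> exists2 r0, 0 < r0 &
  forall r, 0 < r < r0 -> exists2 k, K k & nrm (k - 1%:M - rc r *: Y) <= e * r.

Lemma ugroup_pow K k j : ugroup K -> K k -> K (k ^+ j).
Proof.
case=> _ K1 KM _ Kk; elim: j => [|j IH]; first by rewrite expr0.
by rewrite exprS; exact: KM.
Qed.

Lemma nrm_dir U : U != 1%:M -> nrm (dir U) = 1.
Proof.
move=> U1; have s0 : 0 < nrm (U - 1%:M) by rewrite nrm_gt0// subr_eq0.
by rewrite dir_def nrmZ gtr0_norm ?invr_gt0// mulVf// gt_eqF.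
Qed.

Lemma dirE U : U != 1%:M -> U - 1%:M = rc (nrm (U - 1%:M)) *: dir U.
Proof.
move=> U1; have s0 : 0 < nrm (U - 1%:M) by rewrite nrm_gt0// subr_eq0.
by rewrite dir_def scalerA -rcM divff ?gt_eqF// rc1 scale1r.
Qed.

(** Unitarity says that the Hermitian part of [U - 1] is quadratic in [U - 1], so it stays small
    after normalisation and vanishes in the limit. *)
Lemma dir_skew U : U \is unitarymx -> U != 1%:M ->
  nrm (dir U + (dir U)^t*) <= nrm (U - 1%:M).
Proof.
move=> uU U1; have s0 : 0 < nrm (U - 1%:M) by rewrite nrm_gt0// subr_eq0.
rewrite dir_def trmxC_scale -scalerDr nrmZ gtr0_norm ?invr_gt0//.
rewrite -ler_pdivlMl ?invr_gt0// invrK.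
have -> : U - 1%:M + (U - 1%:M)^t* = - ((U - 1%:M) *m (U - 1%:M)^t*).
  rewrite trmxC_add trmxC_opp trmxC1 mulmxBr mulmxBl mulmx1 mul1mx unit_mulV//.
  by apply/matrixP => i j; rewrite !mxE; ring.
by rewrite nrmN (le_trans (nrmM _ _))// nrm_adj.
Qed.

Lemma direction (q : nat -> 'M[C]_n) :
  (forall i, q i \is unitarymx) -> (forall i, q i != 1%:M) -> mcvg q 1%:M ->
  exists2 phi, subsequence phi &
    exists Y, [/\ mcvg ((fun i => dir (q i)) \o phi) Y, nrm Y = 1 & skewherm Y].
Proof.
move=> uq q1 cq; have [i|phi h [Y cY]] := @bounded_mcvg R n n (fun i => dir (q i)) 1.
  by rewrite /= nrm_dir.
exists phi => //; exists Y; split => //.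
  have := mcvg_nrm cY; rewrite (_ : (fun i => _) = fun=> 1); last first.
    by apply/funext => i; rewrite /= nrm_dir.
  by move=> h1; apply: (cvg_unique _ h1) => //; exact: cvg_cst.
apply/eqP; rewrite -subr_eq0 opprK addrC; apply/eqP.
apply: (mcvg_unique (mcvgD cY (mcvg_adj cY))).
apply: (mcvg_squeeze _ (mcvg_sub h cq)) => i; rewrite subr0; exact: dir_skew.
Qed.

(** Limits of directions are tangent in every small length [r]: if [k i] is much closer to 1 than
    [r], a suitable power of it lies near [1 + r Y]. *)
Lemma tangent_dir K (k : nat -> 'M[C]_n) Y : ugroup K ->
  (forall i, K (k i)) -> (forall i, k i != 1%:M) -> mcvg k 1%:M ->
  mcvg (fun i => dir (k i)) Y -> nrm Y = 1 -> tangent K Y.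
Proof.
move=> gK Kk k1 ck cY Y1 e e0; exists (e / 2); first by rewrite divr_gt0.
move=> r /andP[r0 re].
have e4 : 0 < e / 4 by rewrite divr_gt0.
have re4 : 0 < r * (e / 4) by rewrite mulr_gt0.
have [i [ki Yi]] : exists i, nrm (k i - 1%:M) < r * (e / 4) /\ nrm (dir (k i) - Y) < e / 4.
  move/cvgrPdist_lt : ck => /(_ _ re4)[N1 _ H1].
  move/cvgrPdist_lt : cY => /(_ _ e4)[N2 _ H2].
  exists (maxn N1 N2); split.
    by have := H1 _ (leq_maxl N1 N2); rewrite sub0r normrN ger0_norm ?nrm_ge0.
  by have := H2 _ (leq_maxr N1 N2); rewrite sub0r normrN ger0_norm ?nrm_ge0.
have uk : k i \is unitarymx by case: gK => + _ _ _; apply.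
have s0 : 0 < nrm (k i - 1%:M) by rewrite nrm_gt0// subr_eq0.
have kE := dirE (k1 i).
set s := nrm _ in ki s0 kE.
(* The power [j] travels the distance [r] up to one step of length [s]. The errors are at most
   [r * e / 2] from the second-order term, since [r < e / 2], and [r * e / 4] each from the
   direction and from rounding. *)
pose j := Num.truncn (r / s).
have /andP[j1 j2] : j%:R <= r / s < j.+1%:R.
  by apply: truncn_itv; rewrite divr_ge0// ltW.
rewrite ler_pdivlMr// in j1; rewrite ltr_pdivrMr// -natr1 in j2.
exists (k i ^+ j); first exact: ugroup_pow.
have -> : k i ^+ j - 1%:M - rc r *: Y = (k i ^+ j - 1%:M - rc j%:R *: (k i - 1%:M)) +
   (rc (j%:R * s) *: (dir (k i) - Y) + rc (j%:R * s - r) *: Y).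
  rewrite kE scalerA -rcM rcD rcN scalerBr scalerBl.
  move: (k i ^+ j) (dir (k i)) (rc (_ * _)) (rc r) => P Z a b.
  by rewrite [X in _ = _ + X]addrA subrK addrA subrK.
apply: le_trans (nrmD _ _) _; apply: le_trans (lerD (nrm_pow2 j uk) (nrmD _ _)) _.
rewrite !nrmZ Y1 -/s.
have j0 : 0 <= j%:R * s by rewrite mulr_ge0// ltW.
have h1 : `|j%:R * s| * nrm (dir (k i) - Y) <= r * (e / 4).
  by rewrite ger0_norm// ler_pM ?nrm_ge0// ltW.
have h2 : `|j%:R * s - r| * 1 <= r * (e / 4).
  rewrite mulr1 ler0_norm ?subr_le0// opprB; lra.
have h3 : (j%:R * s) ^+ 2 <= r * (e / 2).
  by rewrite expr2 ler_pM// (le_trans j1)// ltW.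
by apply: le_trans (lerD h3 (lerD h1 h2)) _; lra.
Qed.

Lemma tangent_adj K Y : ugroup K -> tangent K Y -> tangent K (Y^t*).
Proof.
case=> _ _ _ KV tY e /tY[r0 r00 H]; exists r0 => // r /H[k Kk hk].
exists (k^t*); first exact: KV.
by rewrite -(trmxC1 R n) -trmxC_scale -!trmxC_opp -!trmxC_add nrm_adj.
Qed.

Lemma tangent_conj K Y h : ugroup K -> K h -> tangent K Y ->
  tangent K (h *m Y *m h^t*).
Proof.
case=> Ku _ KM KV Kh tY e /tY[r0 r00 H]; exists r0 => // r /H[k Kk hk].
exists (h *m k *m h^t*); first by apply: (KM); [exact: KM|exact: KV].
have -> : h *m k *m h^t* - 1%:M - rc r *: (h *m Y *m h^t*) =
  h *m (k - 1%:M - rc r *: Y) *m h^t*.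
  by rewrite !(mulmxBr, mulmxBl) mulmx1 unit_mulV ?Ku// -scalemxAr -scalemxAl.
by rewrite nrmUr ?trmxC_unitary ?Ku// nrmUl// Ku.
Qed.

Lemma tangent_max_le K x Y : (forall k, K k -> rtr (k *m x) <= rtr x) ->
  tangent K Y -> rtr (Y *m x) <= 0.
Proof.
move=> mx tY; rewrite leNgt; apply/negP => c0; set c := rtr _ in c0.
have x0 : 0 < nrm x + 1 by rewrite ltr_wpDl ?nrm_ge0.
(* With this precision the approximation error costs at most half of the gain [c * r] along [Y],
   which contradicts maximality; the [+ 1] keeps the divisor positive. *)
have [|r0 r00 H] := tY (c / (2 * (nrm x + 1))); first by rewrite divr_gt0// mulr_gt0.
have [|k /mx kx hk] := H (r0 / 2); first by rewrite divr_gt0//= ltr_pdivrMr// ltr_pMr// ltr1n.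
move: (r0 / 2) (divr_gt0 r00 (ltr0n R 2)) hk => r rp hk.
set E := _ - _ in hk.
have kE : k = 1%:M + rc r *: Y + E by rewrite /E -addrA [rc r *: Y + _]addrC subrK addrC subrK.
clearbody E; move: kx; rewrite kE !mulmxDl mul1mx !rtrD -scalemxAl rtrZ => kx.
have := rtrM_le E x; rewrite ler_norml => /andP[hE _].
have h : nrm E * nrm x <= c * r / 2.
  have -> : c * r / 2 = (c / (2 * (nrm x + 1)) * r) * (nrm x + 1).
    by field; rewrite gt_eqF.
  by rewrite ler_pM ?nrm_ge0// lerDl.
have cr : 0 < c * r by rewrite mulr_gt0.
move: kx hE h cr; move: (rtr x) (rtr _) (nrm E * _); rewrite -/c (mulrC r).
by move: (c * r) => a b d f; lra.
Qed.

(** The adjoint of [Y], which is [- Y], is tangent as well, so the one-sided condition holds in both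
    directions. *)
Lemma tangent_max K x Y : ugroup K -> (forall k, K k -> rtr (k *m x) <= rtr x) ->
  tangent K Y -> skewherm Y -> rtr (Y *m x) = 0.
Proof.
move=> gK mx tY sY; apply/eqP; rewrite eq_le (tangent_max_le mx tY)/=.
have := tangent_max_le mx (tangent_adj gK tY).
by rewrite sY mulNmx rtrN oppr_le0.
Qed.

Lemma rtr_argmax K x : ugroup K -> seqcompact K ->
  exists2 k, K k & forall k', K k' -> rtr (k' *m x) <= rtr (k *m x).
Proof.
move=> [Ku K1 KM _] cK; pose S := [set rtr (k *m x) | k in K].
have Sb : has_sup S.
  split; first by exists (rtr (1%:M *m x)), 1%:M.
  exists (Num.sqrt n%:R * nrm x) => _ [k Kk <-].
  apply: le_trans (ler_norm _) _; apply: le_trans (rtrM_le _ _) _.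
  by rewrite (nrmE k) nsq_unitary ?Ku.
have /choice[u uP] : forall i, exists k, K k /\ sup S - i.+1%:R^-1 < rtr (k *m x).
  by move=> i; have [//|_ [k Kk <-] h] := @sup_adherent _ S (i.+1%:R^-1) _ Sb; exists k.
have [p [Kp [phi h cp]]] := cK u (fun i => (uP i).1).
exists p => // k' Kk'; apply: (@le_trans _ _ (sup S)).
  by apply: ub_le_sup; [exact: Sb.2|exists k'].
have c1 : (fun i => rtr (u (phi i) *m x)) @ \oo --> rtr (p *m x).
  by apply: mcvg_rtr; apply: mcvgM => //; exact: mcvg_cst.
have c2 : (fun i => sup S - (phi i).+1%:R^-1) @ \oo --> sup S.
  rewrite -[X in _ --> X]subr0; apply: cvgB; first exact: cvg_cst.
  exact: (cvg_subsequence h (@cvg_invS R)).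
rewrite -(cvg_lim _ c1)// -(cvg_lim _ c2)//.
apply: ler_lim; [by apply/cvg_ex; eexists; exact: c2|by apply/cvg_ex; eexists; exact: c1|].
by apply: nearW => i; rewrite ltW// (uP (phi i)).2.
Qed.

Lemma nrm_unit1_le U (V : 'M[C]_n) : U \is unitarymx -> V \is unitarymx ->
  (nrm (U - 1%:M) <= nrm (V - 1%:M)) = (rtr V <= rtr U).
Proof.
move=> uU uV; rewrite !nrmE ler_sqrt ?nsq_ge0// !nsq_unit1//.
by rewrite ler_pM2l// lerD2l lerN2.
Qed.

(* If both x and k x maximise the trace over the coset K x, then comparing the
   first-order conditions at x and k x in the direction Y of k - 1 gives
   Re tr (Y Y) = 0 in the limit, although Y is skewherm and of norm 1. *)
Lemma centralizing_representative K : ugroup K -> seqcompact K ->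
  exists2 e, 0 < e & forall x, x \is unitarymx ->
    (forall k, K k -> K (k *m x *m k^t* *m x^t*)) ->
    nrm (x - 1%:M) < e ->
    exists2 k, K k & forall l, K l -> l *m (k *m x) = (k *m x) *m l.
Proof.
move=> gK cK; have [Ku K1 KM KV] := gK; apply: contrapT => H.
(* If no radius works, there are normalising elements [x i] tending to 1 whose cosets contain no
   element centralising [K]. *)
have /choice[x xP] : forall i : nat, exists x : 'M[C]_n, [/\ x \is unitarymx,
    forall k, K k -> K (k *m x *m k^t* *m x^t*), nrm (x - 1%:M) < i.+1%:R^-1 &
    forall k, K k -> exists2 l, K l & l *m (k *m x) <> (k *m x) *m l].
  move=> i; apply: contrapT => Hx; apply: H; exists i.+1%:R^-1 => // x ux nx xs.
  apply: contrapT => Hk; apply: Hx; exists x; split=> // k Kk.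
  apply: contrapT => Hl; apply: Hk; exists k => // l Kl.
  by apply: contrapT => e; apply: Hl; exists l.
have /choice[k kP] : forall i, exists k, K k /\
    forall l, K l -> rtr (l *m x i) <= rtr (k *m x i).
  by move=> i; have [k] := rtr_argmax (x i) gK cK; exists k.
pose y i := k i *m x i.
have Kk i : K (k i) by have [] := kP i.
have ux i : x i \is unitarymx by have [] := xP i.
have uy i : y i \is unitarymx by rewrite mul_unitarymx// Ku.
have y_max i l : K l -> rtr (l *m y i) <= rtr (y i).
  by move=> Kl; rewrite mulmxA; have [_] := kP i; apply; exact: KM.
have cy : mcvg y 1%:M.
  apply: (mcvg_squeeze _ (@cvg_invS R)) => i.
  have [_ _ /ltW xi _] := xP i; apply: le_trans xi.
  by rewrite nrm_unit1_le// -{1}[x i]mul1mx; have [_] := kP i; apply.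
have /choice[l lP] : forall i, exists l, K l /\ l *m y i <> y i *m l.
  by move=> i; have [_ _ _ /(_ _ (Kk i))[l Kl ne]] := xP i; exists l.
have ul i : l i \is unitarymx by apply: Ku; have [] := lP i.
(* As [x i] normalises [K], the commutator [q i] lies in [K]. Moreover [q i *m y i] is a conjugate
   of [y i], so it has the same trace and is a second maximiser on the coset. *)
pose q i := l i *m y i *m (l i)^t* *m (y i)^t*.
have qy i : q i *m y i = l i *m y i *m (l i)^t*.
  by rewrite /q -mulmxA unit_Vmul// mulmx1.
have Kq i : K (q i).
  have [_ nx _ _] := xP i; have [Kl _] := lP i.
  have -> : q i = l i *m k i *m (l i)^t* *m (l i *m x i *m (l i)^t* *m (x i)^t*) *m (k i)^t*.
    rewrite /q /y trmxC_mul; move: (l i) (k i) (x i) (ul i) => L k' x' uL.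
    move: (L^t*) (k'^t*) (x'^t*) (unit_Vmul uL) => L1 k1 x1 LL.
    by rewrite !mulmxA -(mulmxA (L *m k') L1 L) LL mulmx1.
  by apply: (KM); [apply: (KM); [apply: (KM); [exact: KM|exact: KV]|exact: nx]|exact: KV].
have uq i : q i \is unitarymx by exact: Ku.
have q1 i : q i != 1%:M.
  apply/eqP => qi; have [_] := lP i; apply.
  have := qy i; rewrite qi mul1mx => {2}->.
  by rewrite -mulmxA unit_Vmul// mulmx1.
have rtrq i : rtr (q i *m y i) = rtr (y i).
  by rewrite qy rtrC mulmxA unit_Vmul// mul1mx.
have qy_max i m : K m -> rtr (m *m (q i *m y i)) <= rtr (q i *m y i).
  by move=> Km; rewrite rtrq mulmxA; apply: y_max; exact: KM.
have cq : mcvg q 1%:M.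
  apply: (@mcvg_squeeze _ _ _ _ _ (fun i => 2 * nrm (y i - 1%:M))) => [i|].
    rewrite -(nrmUr _ (uy i)) mulmxBl mul1mx.
    apply: le_trans (nrm_trans 1%:M _ _) _.
    rewrite (nrmBC 1%:M) mulr_natl mulr2n lerD2r nrm_unit1_le// ?rtrq//.
    exact: mul_unitarymx.
  by rewrite -[X in _ --> X](mulr0 2); apply: cvgM => //; exact: cvg_cst.
have [phi h [Y [cY Y1 sY]]] := direction uq q1 cq.
have tY : tangent K Y := @tangent_dir K (q \o phi) Y gK (fun i => Kq (phi i))
  (fun i => q1 (phi i)) (mcvg_sub h cq) cY Y1.
(* The difference of the first-order conditions at [q i *m y i] and at [y i], divided by the norm of
   [q i - 1]. *)
have YZ i : rtr (Y *m dir (q i) *m y i) = 0.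
  rewrite dir_def -scalemxAr -scalemxAl rtrZ -mulmxA mulmxBl mul1mx mulmxBr rtrB.
  rewrite (tangent_max gK (y_max i) tY sY) (tangent_max gK (qy_max i) tY sY).
  by rewrite subr0 mulr0.
have c0 : (fun i => rtr (Y *m dir (q (phi i)) *m y (phi i))) @ \oo --> rtr (Y *m Y *m 1%:M).
  apply: mcvg_rtr; apply: mcvgM; last exact: (mcvg_sub h cy).
  by apply: mcvgM; [exact: mcvg_cst|exact: cY].
have : rtr (Y *m Y *m 1%:M) = 0.
  apply: (cvg_unique _ c0) => //.
  rewrite (_ : (fun i => _) = fun=> 0); first exact: cvg_cst.
  by apply/funext => i; exact: YZ.
have -> : Y *m Y *m 1%:M = - (Y *m Y^t*) by rewrite sY mulmxN opprK mulmx1.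
rewrite rtrN rtr_sq -nrm_sq Y1 expr1n => /eqP.
by rewrite oppr_eq0 oner_eq0.
Qed.
End UnitaryGroups.

(** * Complex modulus and first-order expansion of products *)

Section Modulus.
Variable R : realType.
Local Notation C := (Cplx R).

Implicit Types z w : C.

Definition nc z : R := Num.sqrt (csq z).

Lemma nc_ge0 z : 0 <= nc z. Proof. exact: sqrtr_ge0. Qed.
Lemma csq_nat k : csq k%:R = k%:R ^+ 2 :> R.
Proof. by rewrite -rc_nat /csq cre_rc expr0n addr0. Qed.
Lemma nc0 : nc 0 = 0.
Proof. by rewrite /nc (csq_nat 0) expr0n sqrtr0. Qed.
Lemma ncD z w : nc (z + w) <= nc z + nc w.
Proof. by case: z w => [a b] [c d]; exact: (@le_normcD R (Complex a b) (Complex c d)). Qed.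
Lemma csqM z w : csq (z * w) = csq z * csq w.
Proof. by case: z w => [a b] [c d]; rewrite /csq /=; ring. Qed.
Lemma ncM z w : nc (z * w) = nc z * nc w.
Proof. by rewrite /nc csqM sqrtrM ?csq_ge0. Qed.
Lemma cre_le_nc z : `|cre z| <= nc z.
Proof. by rewrite /nc -sqrtr_sqr ler_sqrt ?csq_ge0// lerDl sqr_ge0. Qed.

(** A product of numbers in the unit disc is, to first order, 1 plus the sum of the deviations;
    applied to eigenvalues this compares determinant and trace. *)
Lemma nc_prod (I : Type) (s : seq I) (u : I -> C) : (forall i, nc (u i) <= 1) ->
  let S := \sum_(i <- s) nc (u i - 1) in
  nc (\prod_(i <- s) u i - 1) <= S /\
  nc (\prod_(i <- s) u i - 1 - \sum_(i <- s) (u i - 1)) <= S ^+ 2.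
Proof.
move=> u1; elim: s => [|i s [IH1 IH2]] /=.
  by rewrite !big_nil subrr subr0 nc0 expr0n; split; exact: lexx.
rewrite !big_cons; set S := \sum_(j <- s) nc _ in IH1 IH2 *.
set P := \prod_(j <- s) _ in IH1 IH2 *; set T := \sum_(j <- s) _ in IH2 *.
have S0 : 0 <= S by apply: sumr_ge0 => j _; exact: nc_ge0.
have a0 := nc_ge0 (u i - 1).
split.
  have -> : u i * P - 1 = u i * (P - 1) + (u i - 1) by ring.
  apply: le_trans (ncD _ _) _; rewrite ncM addrC lerD2l.
  by apply: le_trans IH1; rewrite ler_piMl ?nc_ge0.
have -> : u i * P - 1 - (u i - 1 + T) = (u i - 1) * (P - 1) + (P - 1 - T) by ring.
apply: le_trans (ncD _ _) _; rewrite ncM.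
have h : nc (u i - 1) * nc (P - 1) <= nc (u i - 1) * S by rewrite ler_wpM2l.
clear IH1; clearbody S.
move: (nc (P - 1 - T)) IH2 h a0 S0 => x; move: (nc _ * nc (P - 1)) => y.
by move: (nc _) S => a S; nra.
Qed.
End Modulus.

(** * Diagonalisation, determinants and traces near the identity *)

Section Spectral.
Variables (R : realType) (n : nat).
Local Notation C := (Cplx R).
Implicit Types A U Y : 'M[C]_n.

Lemma normal_diag A : A *m A^t* = A^t* *m A ->
  exists2 P : 'M[C]_n, P \is unitarymx & exists d, A = P^t* *m diag_mx d *m P.
Proof.
move=> /normalmxP/orthomx_spectralP h; exists (spectralmx A); first exact: spectral_unitarymx.
by exists (spectral_diag A); rewrite {1}h invmx_unitary// spectral_unitarymx.
Qed.

Lemma conj_unitaryK (P A : 'M[C]_n) : P \is unitarymx -> P *m (P^t* *m A *m P) *m P^t* = A.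
Proof.
move=> uP; rewrite -!mulmxA unit_mulV// mulmx1 mulmxA unit_mulV// mul1mx//.
Qed.

(** After diagonalisation the determinant is the product of the eigenvalues, each of modulus 1 and
    at distance at most [nrm (U - 1%:M)] from 1. *)
Lemma nc_tr_det_unit1 U : U \is unitarymx ->
  nc (\det U - 1) <= n%:R * nrm (U - 1%:M) /\
  nc (\det U - 1 - \tr (U - 1%:M)) <= (n%:R * nrm (U - 1%:M)) ^+ 2.
Proof.
move=> uU.
have [|P uP [d Ud]] := @normal_diag U; first by rewrite unit_mulV// unit_Vmul.
have UD : diag_mx d = P *m U *m P^t* by rewrite Ud conj_unitaryK.
have dl i : nc (d 0 i) <= 1.
  have : diag_mx d \is unitarymx.
    by rewrite UD; apply: mul_unitarymx; [exact: mul_unitarymx|rewrite trmxC_unitary].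
  move=> /unit_mulV/matrixP/(_ i i); rewrite !mxE eqxx (bigD1 i)//= big1 => [|j ji].
    rewrite !mxE eqxx mulr1n addr0 mul_conj_csq => -[e].
    by rewrite /nc e sqrtr1.
  by rewrite !mxE eq_sym (negPf ji) mulr0n mul0r.
have d1 i : nc (d 0 i - 1) <= nrm (U - 1%:M).
  have -> : nrm (U - 1%:M) = nrm (diag_mx d - 1%:M).
    have -> : diag_mx d - 1%:M = P *m (U - 1%:M) *m P^t*.
      by rewrite UD mulmxBr mulmxBl mulmx1 unit_mulV.
    by rewrite nrmUr ?trmxC_unitary// nrmUl.
  rewrite nrmE ler_sqrt ?nsq_ge0//; apply: le_trans (csq_le_nsq _ i i).
  by rewrite !mxE eqxx !mulr1n.
have tE : \tr (U - 1%:M) = \sum_i (d 0 i - 1).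
  rewrite raddfB /= Ud mxtrace_mulC mulmxA unit_mulV// mul1mx mxtrace_diag mxtrace1 sumrB.
  by rewrite sumr_const card_ord.
have [] := @nc_prod R _ (index_enum 'I_n) (fun i => d 0 i) dl.
have -> : \prod_(i < n) d 0 i = \det U.
  by rewrite -det_diag UD !det_mulmx mulrAC -det_mulmx unit_mulV// det1 mul1r.
rewrite -tE.
have S0 : 0 <= \sum_i nc (d 0 i - 1) by apply: sumr_ge0 => j _; exact: nc_ge0.
have Sn : \sum_i nc (d 0 i - 1) <= n%:R * nrm (U - 1%:M).
  rewrite mulr_natl -[X in _ <= _ *+ X](card_ord n) -sumr_const.
  by apply: ler_sum => i _.
move=> h1 h2; split; first exact: le_trans Sn.
by apply: le_trans h2 _; rewrite lerXn2r ?nnegrE ?mulr_ge0 ?nrm_ge0.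
Qed.

Lemma nc_tr_unit1 U : U \is unitarymx -> \det U = 1 ->
  nc (\tr (U - 1%:M)) <= (n%:R * nrm (U - 1%:M)) ^+ 2.
Proof.
move=> /nc_tr_det_unit1[_ +] dU; rewrite dU subrr sub0r.
have -> // : nc (- \tr (U - 1%:M)) = nc (\tr (U - 1%:M)).
by move: (\tr _) => -[a b]; rewrite /nc /csq /= !sqrrN.
Qed.

(** The choices [c = 1] and [c = -i] read off the real and imaginary parts, so complex traces can be
    handled through [rtr]. *)
Lemma cre_mul_eq0 (z : C) : (forall c : C, csq c = 1 -> cre (c * z) = 0) -> z = 0.
Proof.
move=> h; apply/eqP; rewrite eq_complex /=.
have := h 1; rewrite mul1r /csq /= expr1n expr0n addr0 => /(_ erefl) e1.
have := h (Complex 0 (-1) : C); rewrite /csq /= sqrrN expr1n expr0n add0r => /(_ erefl).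
rewrite creM /= mul0r sub0r mulN1r opprK => e2.
by apply/andP; split; apply/eqP; [exact: e1|exact: e2].
Qed.

Lemma cre_mul_tr (c : C) A : cre (c * \tr A) = rtr (c%:M *m A).
Proof. by rewrite rtr.unlock mul_scalar_mx mxtraceZ. Qed.

Lemma mcvg_tr0 (u : nat -> 'M[C]_n) Y : mcvg u Y ->
  (fun i => nc (\tr (u i))) @ \oo --> (0 : R) -> \tr Y = 0.
Proof.
move=> cu c0; apply: cre_mul_eq0 => c c1; rewrite cre_mul_tr.
have h := mcvg_rtr (mcvgM (mcvg_cst c%:M) cu).
apply: (cvg_unique _ h) => //; apply/cvgrPdist_lt => e e0.
move/cvgrPdist_lt : c0 => /(_ e e0); apply: filterS => i; rewrite !sub0r !normrN.
apply: le_lt_trans; rewrite -cre_mul_tr; apply: le_trans (cre_le_nc _) _.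
by rewrite ncM {1}/nc c1 sqrtr1 mul1r ler_norm.
Qed.

(** Determinant 1 makes the trace of [q i - 1] quadratically small, so it tends to 0 even after
    division by the norm. *)
Lemma dir_traceless (q : nat -> 'M[C]_n) Y : (forall i, q i \is unitarymx) ->
  (forall i, \det (q i) = 1) -> (forall i, q i != 1%:M) -> mcvg q 1%:M ->
  mcvg (fun i => dir (q i)) Y -> \tr Y = 0.
Proof.
move=> uq dq q1 cq cY; apply: (mcvg_tr0 cY).
apply: (@cvg0_squeeze _ _ (fun i => n%:R ^+ 2 * nrm (q i - 1%:M))) => [i|].
  rewrite nc_ge0/=; have s0 : 0 < nrm (q i - 1%:M) by rewrite nrm_gt0// subr_eq0.
  have := nc_tr_unit1 (uq i) (dq i).
  rewrite {1}(dirE (q1 i)) mxtraceZ ncM; move: (nrm _) s0 => s s0.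
  have -> : nc (rc s) = s.
    by rewrite /nc /csq /= expr0n addr0 sqrtr_sqr gtr0_norm.
  have -> : (n%:R * s) ^+ 2 = s * (n%:R ^+ 2 * s) by ring.
  by rewrite ler_pM2l.
by rewrite -[X in _ --> X](mulr0 (n%:R ^+ 2)); apply: cvgM => //; exact: cvg_cst.
Qed.

Lemma skew_rtr Y : skewherm Y -> rtr Y = 0.
Proof. by move=> sY; have := rtr_adj Y; rewrite sY rtrN; move: (rtr Y) => a; lra. Qed.

Lemma mcvg_skew (u : nat -> 'M[C]_n) Y : (forall i, skewherm (u i)) -> mcvg u Y -> skewherm Y.
Proof.
move=> su cu; apply: (mcvg_unique (mcvg_adj cu)).
by apply: mcvg_eq (mcvgN cu) => i; rewrite su.
Qed.

Lemma mcvg_traceless (u : nat -> 'M[C]_n) Y : (forall i, \tr (u i) = 0) -> mcvg u Y -> \tr Y = 0.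
Proof.
move=> tu /mcvg_tr0; apply; rewrite (_ : (fun i => _) = fun=> 0); first exact: cvg_cst.
by apply/funext => i; rewrite tu nc0.
Qed.

Lemma mcvg_nrm1 (u : nat -> 'M[C]_n) Y : (forall i, nrm (u i) = 1) -> mcvg u Y -> nrm Y = 1.
Proof.
move=> nu /mcvg_nrm h; apply: (cvg_unique _ h) => //.
by rewrite (_ : (fun i => _) = fun=> 1); [exact: cvg_cst|apply/funext].
Qed.
End Spectral.

(** * Closed subgroups close to SU(n) *)

Section PlaneRotations.
Variables (R : realType) (m : nat).
Local Notation C := (Cplx R).

(** The matrix form of a quaternion; those with [a * a^* + b * b^* = 1] form SU(2). *)
Definition q2 (a b : C) : 'M[C]_2 := \matrix_(i, j)
  if i == 0 then (if j == 0 then a else - b^*) else (if j == 0 then b else a^*).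

Lemma sum2 (V : zmodType) (F : 'I_2 -> V) : \sum_i F i = F 0 + F 1.
Proof. by rewrite big_ord_recl big_ord1; congr (_ + F _); apply: val_inj. Qed.

Lemma ord2P (P : 'I_2 -> Prop) : P 0 -> P 1 -> forall i, P i.
Proof.
move=> P0 P1 [[|[|//]] h]; first by rewrite (_ : Ordinal _ = 0) //; apply: val_inj.
by rewrite (_ : Ordinal _ = 1) //; apply: val_inj.
Qed.

Lemma q2M a b c d : q2 a b *m q2 c d = q2 (a * c - b^* * d) (b * c + a^* * d).
Proof.
apply/matrixP; apply: ord2P; apply: ord2P; rewrite !mxE sum2 !mxE /=;
  do ?rewrite (rmorphD, rmorphN, rmorphM) /=; rewrite ?conjCK; ring.
Qed.

Lemma q2_adj a b : (q2 a b)^t* = q2 a^* (- b).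
Proof.
apply/matrixP; apply: ord2P; apply: ord2P; rewrite !mxE /= ?rmorphN /= ?opprK ?conjCK//.
Qed.

Lemma q2_1 : q2 1 0 = 1%:M.
Proof.
by apply/matrixP; apply: ord2P; apply: ord2P; rewrite !mxE /= ?rmorph0 ?rmorph1 ?oppr0.
Qed.

Lemma det_q2 a b : \det (q2 a b) = a * a^* + b * b^*.
Proof.
rewrite (expand_det_row _ 0) sum2 /cofactor !det_mx11 !mxE /=.
by rewrite expr0 expr1; ring.
Qed.

Lemma mxtrace_q2 a b : \tr (q2 a b) = a + a^*.
Proof. by rewrite /mxtrace sum2 !mxE. Qed.

Definition emb2 (A : 'M[C]_2) : 'M[C]_(2 + m) := block_mx A 0 0 1%:M.

Lemma emb2M A B : emb2 A *m emb2 B = emb2 (A *m B).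
Proof.
by rewrite /emb2 mulmx_block !(mul0mx, mulmx0, mulmx1, addr0, add0r).
Qed.

Lemma emb2_adj A : (emb2 A)^t* = emb2 (A^t*).
Proof.
by rewrite /emb2 tr_block_mx map_block_mx !trmx0 !map_mx0 trmx1 map_mx1.
Qed.

Lemma emb2_1 : emb2 1%:M = 1%:M.
Proof. by rewrite /emb2 -scalar_mx_block. Qed.

Lemma emb2_SU a b : a * a^* + b * b^* = 1 ->
  emb2 (q2 a b) \in @special_unitary R (2 + m).
Proof.
move=> h; rewrite inE; apply/andP; split.
  apply/unitarymxP; rewrite emb2_adj emb2M q2_adj q2M -emb2_1 -q2_1.
  congr (emb2 (q2 _ _)); first by rewrite -h mulrN opprK [b^* * b]mulrC.
  by rewrite mulrN [b * _]mulrC addrN.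
by rewrite /emb2 det_ublock det1 mulr1 det_q2 h.
Qed.

(** [phase] and [planerot] are one-parameter groups through two anticommuting quaternion units,
    reached at [pi / 2]; at [pi] both arrive at -1 of SU(2). *)
Definition phase (t : R) : 'M[C]_(2 + m) := emb2 (q2 (Complex (cos t) (sin t)) 0).
Definition planerot (t : R) : 'M[C]_(2 + m) := emb2 (q2 (rc (cos t)) (rc (sin t))).

Lemma phase_SU t : phase t \in @special_unitary R (2 + m).
Proof.
apply: emb2_SU; rewrite mul0r addr0 mul_conj_csq /csq /=.
by rewrite cos2Dsin2.
Qed.

Lemma planerot_SU t : planerot t \in @special_unitary R (2 + m).
Proof.
by apply: emb2_SU; rewrite !rc_conj -!rcM -rcD -!expr2 cos2Dsin2.
Qed.

Lemma phaseD s t : phase (s + t) = phase s *m phase t.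
Proof.
rewrite /phase emb2M q2M !(mulr0, mul0r) addr0 subr0; congr (emb2 (q2 _ _)).
by rewrite cosD sinD; apply/eqP; rewrite eq_complex /=; apply/andP; split; apply/eqP => //=; ring.
Qed.

Lemma planerotD s t : planerot (s + t) = planerot s *m planerot t.
Proof.
rewrite /planerot emb2M q2M !rc_conj cosD sinD; congr (emb2 (q2 _ _)).
  by rewrite -!rcM -rcN -rcD.
by rewrite -!rcM -rcD.
Qed.

Lemma phase0 : phase 0 = 1%:M.
Proof. by rewrite /phase cos0 sin0 -emb2_1 -q2_1. Qed.
Lemma planerot0 : planerot 0 = 1%:M.
Proof. by rewrite /planerot cos0 sin0 -emb2_1 -q2_1. Qed.

Lemma phase_pow t k : phase t ^+ k = phase (k%:R * t).
Proof.
elim: k => [|k IH]; first by rewrite mul0r phase0.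
by rewrite exprS IH -natr1 mulrDl mul1r addrC phaseD.
Qed.
Lemma planerot_pow t k : planerot t ^+ k = planerot (k%:R * t).
Proof.
elim: k => [|k IH]; first by rewrite mul0r planerot0.
by rewrite exprS IH -natr1 mulrDl mul1r addrC planerotD.
Qed.

Lemma rtr_emb2 a b : rtr (emb2 (q2 a b)) = 2 * cre a + m%:R.
Proof.
rewrite rtr.unlock /emb2 mxtrace_block mxtrace1 mxtrace_q2 !creD cre_conj.
by rewrite -rc_nat cre_rc mulr_natl.
Qed.

Lemma nsq_emb2 a b : emb2 (q2 a b) \is unitarymx ->
  nsq (emb2 (q2 a b) - 1%:M) = 4 * (1 - cre a).
Proof. by move=> u; rewrite nsq_unit1// rtr_emb2 natrD; ring. Qed.

Lemma SU_unitary n (A : 'M[C]_n) : A \in @special_unitary R n -> A \is unitarymx.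
Proof. by rewrite inE => /andP[]. Qed.
Lemma SU_det n (A : 'M[C]_n) : A \in @special_unitary R n -> \det A = 1.
Proof. by rewrite inE => /andP[_ /eqP]. Qed.

Lemma nsq_phase t : nsq (phase t - 1%:M) = 4 * (1 - cos t).
Proof. exact/nsq_emb2/SU_unitary/phase_SU. Qed.
Lemma nsq_rot t : nsq (planerot t - 1%:M) = 4 * (1 - cos t).
Proof. exact/nsq_emb2/SU_unitary/planerot_SU. Qed.

Lemma cvg_cos_invS t : (fun k => Num.sqrt (4 * (1 - cos (t / k.+1%:R)))) @ \oo --> (0 : R).
Proof.
rewrite -[X in _ --> X](@sqrtr0 R); apply: (continuous_cvg _ (@sqrt_continuous R 0)).
rewrite -[X in _ --> X](mulr0 4); apply: cvgM; first exact: cvg_cst.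
rewrite -[X in _ --> X](subrr 1) -[X in _ --> _ - X]cos0.
apply: cvgB; first exact: cvg_cst.
apply: (continuous_cvg _ (@continuous_cos R 0)).
by rewrite -[X in _ --> X](mulr0 t); apply: cvgM; [exact: cvg_cst|exact: cvg_invS].
Qed.

Lemma mcvg_phase t : mcvg (fun k => phase (t / k.+1%:R)) 1%:M.
Proof.
rewrite /mcvg (_ : (fun i => _) = (fun k => Num.sqrt (4 * (1 - cos (t / k.+1%:R))))).
  exact: cvg_cos_invS.
by apply/funext => k; rewrite nrmE nsq_phase.
Qed.
Lemma mcvg_rot t : mcvg (fun k => planerot (t / k.+1%:R)) 1%:M.
Proof.
rewrite /mcvg (_ : (fun i => _) = (fun k => Num.sqrt (4 * (1 - cos (t / k.+1%:R))))).
  exact: cvg_cos_invS.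
by apply/funext => k; rewrite nrmE nsq_rot.
Qed.

Lemma phase_pi : phase pi = emb2 (q2 (-1) 0).
Proof.
by rewrite /phase cospi sinpi; congr (emb2 (q2 _ _)); apply/eqP; rewrite eq_complex /= oppr0 !eqxx.
Qed.

Lemma phase_pi_neq1 : phase pi != 1%:M.
Proof.
apply/eqP => h; have := nsq_phase pi.
rewrite h subrr nsqI ip.unlock mul0mx linear0 cospi cre0 => e; clear h.
by lra.
Qed.

Lemma planerot_pi : planerot pi = phase pi.
Proof.
rewrite phase_pi /planerot cospi sinpi; congr (emb2 (q2 _ _)).
by apply/eqP; rewrite eq_complex /= oppr0 !eqxx.
Qed.

Lemma phase_pi_sq : phase pi *m phase pi = 1%:M.
Proof. by rewrite -phaseD -mulr2n -mulr_natl /phase mulr_natl cos2pi sin2pi -emb2_1 -q2_1. Qed.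

Lemma phase_pi_rotC t : phase pi *m planerot t = planerot t *m phase pi.
Proof. by rewrite -planerot_pi -!planerotD addrC. Qed.

Lemma phase_rot_half : phase (pi / 2) *m planerot (pi / 2) =
  phase pi *m (planerot (pi / 2) *m phase (pi / 2)).
Proof.
rewrite phase_pi /phase /planerot cos_pihalf sin_pihalf !emb2M !q2M; congr (emb2 (q2 _ _)).
  by rewrite ?rmorph0 ?rmorphN /= !rc_conj !(mulr0, mul0r) ?rmorph1 ?rmorph0 ?mul0r ?mulr0 ?subr0 ?addr0; apply/eqP; rewrite eq_complex /=; apply/andP; split; apply/eqP => /=; ring.
by apply/eqP; rewrite eq_complex /=; apply/andP; split; apply/eqP => /=; ring.
Qed.

End PlaneRotations.

(** * Tangent and normal directions in su(n) *)

Section TangentOfSU.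
Variables (R : realType) (n : nat).
Local Notation C := (Cplx R).
Local Notation SUmx := (@special_unitary R n).
Implicit Types (J : set 'M[C]_n) (Y W g h : 'M[C]_n).

Definition in_su Y := [/\ nrm Y = 1, skewherm Y & \tr Y = 0].

Lemma in_su_limit (u : nat -> 'M[C]_n) : (forall i, in_su (u i)) ->
  exists2 phi, subsequence phi & exists2 Y, in_su Y & mcvg (u \o phi) Y.
Proof.
move=> su; have [i|phi hphi [Y cY]] := @bounded_mcvg R n n u 1.
  by have [-> _ _] := su i.
exists phi => //; exists Y => //; split.
- by apply: mcvg_nrm1 cY => i; have [] := su (phi i).
- by apply: mcvg_skew cY => i; have [] := su (phi i).
- by apply: mcvg_traceless cY => i; have [] := su (phi i).
Qed.

Lemma direction_su (q : nat -> 'M[C]_n) : (forall i, q i \in SUmx) ->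
  (forall i, q i != 1%:M) -> mcvg q 1%:M ->
  exists2 phi, subsequence phi & exists2 Y, in_su Y & mcvg (fun i => dir (q (phi i))) Y.
Proof.
move=> sq q1 cq; have uq i := SU_unitary (sq i).
have [phi hphi [Y [cY Y1 sY]]] := direction uq q1 cq.
exists phi => //; exists Y => //; split=> //.
exact: (@dir_traceless _ _ (q \o phi) Y (fun i => uq (phi i))
  (fun i => SU_det (sq (phi i))) (fun i => q1 (phi i)) (mcvg_sub hphi cq) cY).
Qed.

(* A matrix near 1 outside J, moved to its closest representative modulo J,
   yields in the limit a direction normal to J. *)
Lemma normal_direction J : ugroup J -> seqcompact J -> (forall k, J k -> k \in SUmx) ->
  ~ (exists2 e, 0 < e & forall g, g \in SUmx -> nrm (g - 1%:M) < e -> J g) ->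
  exists2 Y, in_su Y & forall W, tangent J W -> skewherm W -> rtr (W *m Y) = 0.
Proof.
move=> gJ cJ JS nJ; have [_ _ JM JV] := gJ.
have /choice[g gP] : forall i : nat, exists g, [/\ g \in SUmx, nrm (g - 1%:M) < i.+1%:R^-1 & ~ J g].
  move=> i; apply: contrapT => H; apply: nJ; exists i.+1%:R^-1 => // g sg gi.
  by apply: contrapT => Jg; apply: H; exists g.
have /choice[p pP] : forall i, exists p, J p /\
    forall k, J k -> rtr (k *m g i) <= rtr (p *m g i).
  by move=> i; have [p] := rtr_argmax (g i) gJ cJ; exists p.
pose q i := p i *m g i.
have Jp i : J (p i) by have [] := pP i.
have sg i : g i \in SUmx by have [] := gP i.
have sq i : q i \in SUmx.
  have up := SU_unitary (JS _ (Jp i)); have ug := SU_unitary (sg i).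
  rewrite inE; apply/andP; split; first exact: mul_unitarymx.
  by rewrite det_mulmx (SU_det (JS _ (Jp i))) (SU_det (sg i)) mulr1.
have q1 i : q i != 1%:M.
  apply/eqP => qi; have [_ _] := gP i; apply.
  have up := SU_unitary (JS _ (Jp i)).
  by rewrite -(mul1mx (g i)) -(unit_Vmul up) -mulmxA -/(q i) qi mulmx1; exact: JV.
have cq : mcvg q 1%:M.
  apply: (mcvg_squeeze _ (@cvg_invS R)) => i.
  have [_ /ltW gi _] := gP i; apply: le_trans gi.
  rewrite nrm_unit1_le//; [|exact: SU_unitary|exact: SU_unitary].
  by rewrite -{1}[g i]mul1mx; have [_] := pP i; apply; case: gJ.
have [phi hphi [Y suY cY]] := direction_su sq q1 cq.
exists Y => // W tW sW.
have q0 i : rtr (W *m dir (q i)) = 0.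
  rewrite dir_def -scalemxAr rtrZ mulmxBr rtrB mulmx1 (skew_rtr sW) subr0.
  rewrite (tangent_max (K := J))// ?mulr0// => k Jk.
  by rewrite /q mulmxA; have [_] := pP i; apply; exact: JM.
have := mcvg_rtr (mcvgM (mcvg_cst W) cY) => c0.
apply: (cvg_unique _ c0) => //.
by rewrite (_ : (fun i => _) = fun=> 0); [exact: cvg_cst|apply/funext => i; exact: q0].
Qed.

Lemma tangent_su J : ugroup J -> (forall k, J k -> k \in SUmx) ->
  (forall r, 0 < r -> exists k, [/\ J k, k != 1%:M & nrm (k - 1%:M) < r]) ->
  exists2 W, in_su W & tangent J W.
Proof.
move=> gJ JS H.
have /choice[k kP] : forall i : nat, exists k,
    [/\ J k, k != 1%:M & nrm (k - 1%:M) < i.+1%:R^-1].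
  by move=> i; apply: H.
have Jk i : J (k i) by have [] := kP i.
have k1 i : k i != 1%:M by have [] := kP i.
have ck : mcvg k 1%:M.
  by apply: (mcvg_squeeze _ (@cvg_invS R)) => i; rewrite ltW//; have [] := kP i.
have [phi hphi [Y suY cY]] := direction_su (fun i => JS _ (Jk i)) k1 ck.
exists Y => //; have [Y1 _ _] := suY.
exact: (@tangent_dir _ _ J (k \o phi) Y gJ (fun i => Jk (phi i))
  (fun i => k1 (phi i)) (mcvg_sub hphi ck) cY Y1).
Qed.

Lemma conj_unitary (P Q A : 'M[C]_n) : P \is unitarymx -> A \is unitarymx ->
  Q \is unitarymx -> P^t* *m A *m Q \is unitarymx.
Proof.
move=> uP uA uQ; apply: mul_unitarymx uQ; apply: mul_unitarymx uA.
by rewrite trmxC_unitary.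
Qed.

Lemma conj_SU (Q r : 'M[C]_n) : Q \is unitarymx -> r \in SUmx ->
  Q^t* *m r *m Q \in SUmx /\ nrm (Q^t* *m r *m Q - 1%:M) = nrm (r - 1%:M).
Proof.
move=> uQ sr; split.
  rewrite inE; apply/andP; split; first exact: (conj_unitary uQ (SU_unitary sr) uQ).
  rewrite !det_mulmx mulrAC -det_mulmx unit_Vmul// det1 mul1r.
  by apply/eqP/SU_det.
have -> : Q^t* *m r *m Q - 1%:M = Q^t* *m (r - 1%:M) *m Q.
  by rewrite mulmxBr mulmxBl mulmx1 unit_Vmul.
by rewrite (nrmUr _ uQ) nrmUl; [|rewrite trmxC_unitary].
Qed.

Lemma conj_comp (P P1 S S1 D : 'M[C]_n) : S1 *m S = 1%:M ->
  P1 *m D *m P = P1 *m S1 *m (S *m D *m S1) *m (S *m P).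
Proof.
by move=> SS; rewrite !mulmxA -(mulmxA P1 S1 S) SS mulmx1 -(mulmxA _ S1 S) SS mulmx1.
Qed.

Lemma conj_comm (Q Q1 r D : 'M[C]_n) : Q *m Q1 = 1%:M ->
  Q1 *m D *m Q *m (Q1 *m r *m Q) = Q1 *m r *m Q *m (Q1 *m D *m Q) -> D *m r = r *m D.
Proof.
move=> QQ; rewrite !mulmxA -(mulmxA (Q1 *m D)) QQ mulmx1.
rewrite -(mulmxA (Q1 *m r)) QQ mulmx1 => /(congr1 (fun A => Q *m A *m Q1)).
by rewrite !mulmxA QQ !mul1mx -(mulmxA _ Q Q1) -[RHS](mulmxA _ Q Q1) QQ !mulmx1.
Qed.

Lemma diag_comm d (r : 'M[C]_n) i j : diag_mx d *m r = r *m diag_mx d ->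
  r i j != 0 -> d 0 i = d 0 j.
Proof.
move=> /matrixP/(_ i j); rewrite mul_diag_mx mul_mx_diag !mxE mulrC => h r0.
exact: mulfI r0 _ _ h.
Qed.

(** Scaling by an [n]-th root of the inverse determinant leaves conjugation unchanged, because that
    root has modulus 1. *)
Lemma unitary_scale_SU (v : 'M[C]_n) : (0 < n)%N -> v \is unitarymx ->
  exists2 g, g \in SUmx & forall W, g *m W *m g^t* = v *m W *m v^t*.
Proof.
move=> n0 uv; pose l := n.-root (\det v)^-1.
have ln : l ^+ n = (\det v)^-1 by rewrite rootCK.
have dv : \det v * (\det v)^* = 1.
  by have := congr1 (fun A : 'M[C]_n => \det A) (unit_mulV uv);
    rewrite det_mulmx det1 -map_trmx det_tr det_map_mx.
have dv0 : \det v != 0.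
  by apply: contra_eq_neq dv => ->; rewrite mul0r eq_sym oner_eq0.
have ll : l * l^* = 1.
  have h : (l * l^*) ^+ n = 1 by rewrite exprMn -rmorphXn /= ln fmorphV -invfM dv invr1.
  by apply/eqP; rewrite -(@pexpr_eq1 _ _ n) ?mul_conjC_ge0//; apply/eqP.
exists (l *: v).
  rewrite inE; apply/andP; split.
    apply/unitarymxP; rewrite linearZ /= map_mxZ -scalemxAl -scalemxAr scalerA ll scale1r.
    exact: unit_mulV.
  by rewrite detZ ln mulVf.
by move=> W; rewrite linearZ /= map_mxZ -!scalemxAl -scalemxAr scalerA ll scale1r.
Qed.
End TangentOfSU.

(** * Conjugation orbits in su(n) *)

Section AdjointPairing.
Variables (R : realType) (m : nat).
Local Notation C := (Cplx R).
Local Notation n := (2 + m)%N.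
Local Notation SUmx := (@special_unitary R n).
Implicit Types (J : set 'M[C]_n) (Y W g h : 'M[C]_n).

Lemma skew_diag Y : skewherm Y -> exists2 P : 'M[C]_n, P \is unitarymx &
  exists d, Y = P^t* *m diag_mx d *m P /\ forall i, cre (d 0 i) = 0.
Proof.
move=> sY; have [|P uP [d dY]] := @normal_diag R n Y; first by rewrite sY mulmxN mulNmx.
exists P => //; exists d; split => // i.
have dE : diag_mx d = P *m Y *m P^t* by rewrite dY conj_unitaryK.
have : (diag_mx d)^t* = - diag_mx d.
  by rewrite dE !trmxC_mul trmxCK sY mulNmx mulmxN mulmxA.
move=> /matrixP/(_ i i); rewrite !mxE eqxx !mulr1n => h.
by have := cre_conj (d 0 i); rewrite h creN; move: (cre _) => x; lra.
Qed.

Lemma perm_unitary (s : {perm 'I_n}) : (perm_mx s : 'M[C]_n)^t* = perm_mx s^-1.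
Proof. by rewrite tr_perm_mx map_perm_mx. Qed.

Lemma perm_mx_unitary (s : {perm 'I_n}) : (perm_mx s : 'M[C]_n) \is unitarymx.
Proof. by apply/unitarymxP; rewrite perm_unitary -perm_mxM mulgV perm_mx1. Qed.

Lemma perm_conj (s : {perm 'I_n}) (A : 'M[C]_n) i j :
  (perm_mx s *m A *m (perm_mx s)^t*) i j = A (s i) (s j).
Proof. by rewrite perm_unitary -row_permE -col_permE !mxE. Qed.

(** The transposition of [i] and [k] moves [i] to [k] and fixes [j]. *)
Lemma const_of_perm (T : Type) (b : 'I_n -> T) (i j : 'I_n) : i != j ->
  (forall s : {perm 'I_n}, b (s i) = b (s j)) -> forall k, b k = b j.
Proof.
move=> ij H k; have [->//|kj] := eqVneq k j.
by have := H (tperm i k); rewrite tpermL tpermD// eq_sym.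
Qed.

Lemma diag_const_eq0 Y (P : 'M[C]_n) d (i : 'I_n) : Y = P^t* *m diag_mx d *m P ->
  P \is unitarymx -> \tr Y = 0 -> (forall k, d 0 k = d 0 i) -> Y = 0.
Proof.
move=> -> uP; rewrite mxtrace_mulC mulmxA unit_mulV// mul1mx mxtrace_diag => tY dk.
have : n%:R * d 0 i = 0.
  by rewrite -tY (eq_bigr (fun=> d 0 i))// sumr_const card_ord mulr_natl.
move=> /eqP; rewrite mulf_eq0 pnatr_eq0 /= => /eqP d0.
have -> : d = 0 by apply/rowP => k; rewrite dk d0 mxE.
by rewrite linear0 mulmx0 mul0mx.
Qed.

(** Commuting with a small rotation in the plane of two eigenvectors forces their eigenvalues to
    agree. So [Y] is scalar, and having trace 0 it vanishes. *)
Lemma commutes_small_SU Y e : 0 < e -> skewherm Y -> \tr Y = 0 ->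
  (forall h, h \in SUmx -> nrm (h - 1%:M) < e -> Y *m h = h *m Y) -> Y = 0.
Proof.
move=> e0 sY tY H; have [P uP [d [dY _]]] := skew_diag sY.
have [t [s0 te]] : exists t : R, sin t != 0 /\ nrm (planerot m t - 1%:M) < e.
  have /cvgrPdist_lt/(_ e e0)[N _ HN] := @mcvg_rot R m (pi / 2).
  exists (pi / 2 / N.+1%:R); split; last first.
    by have := HN N (leqnn N); rewrite sub0r normrN ger0_norm ?nrm_ge0.
  rewrite gt_eqF// sin_gt0_pi// !divr_gt0 ?pi_gt0//=.
  rewrite ltr_pdivrMr// ltr_pdivrMr// -mulrA ltr_pMr ?pi_gt0// -natrM ltr1n.
  by rewrite muln2.
have dij (s : {perm 'I_n}) : d 0 (s 0) = d 0 (s 1).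
  pose Q := perm_mx s *m P; have uQ : Q \is unitarymx.
    exact: mul_unitarymx (perm_mx_unitary s) uP.
  pose r := Q^t* *m planerot m t *m Q.
  have [sr rE] := conj_SU uQ (planerot_SU m t).
  have nr : nrm (r - 1%:M) < e by rewrite rE.
  pose d' := \row_i d 0 (s i).
  have Dd : diag_mx d' = perm_mx s *m diag_mx d *m (perm_mx s)^t*.
    by apply/matrixP => i j; rewrite perm_conj !mxE (inj_eq perm_inj).
  have YE : Y = Q^t* *m diag_mx d' *m Q.
    by rewrite dY /Q trmxC_mul Dd; exact/conj_comp/unit_Vmul/perm_mx_unitary.
  have := H r sr nr; rewrite YE => /(conj_comm (unit_mulV uQ)).
  have dE i : d' 0 i = d 0 (s i) by rewrite mxE.
  move=> /(@diag_comm _ _ d' _ 1 0); rewrite !dE => h; symmetry; apply: h.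
  have r10 : planerot m t 1 0 = rc (sin t).
    rewrite /planerot /emb2 (_ : 1 = lshift m (1 : 'I_2)); last exact: val_inj.
    rewrite (_ : 0 = lshift m (0 : 'I_2)); last exact: val_inj.
    by rewrite block_mxEul mxE.
  have rt0 : rc (sin t) != 0 :> C.
    by apply: contra_neq s0 => h; rewrite -(cre_rc (sin t)) h.
  by rewrite r10.
apply: (@diag_const_eq0 Y P d 1 dY uP tY).
exact: (@const_of_perm _ (fun i => d 0 i) 0 1).
Qed.

(** With both matrices diagonalised, the unitaries that permute one eigenbasis onto the other turn
    the hypothesis into identities between the two lists of eigenvalues. *)
Lemma trace_pairing_unitary Y W : skewherm Y -> skewherm W -> \tr Y = 0 -> \tr W = 0 ->
  (forall v, v \is unitarymx -> rtr (v *m W *m v^t* *m Y) = 0) -> Y = 0 \/ W = 0.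
Proof.
move=> sY sW tY tW H.
have [P uP [y [dY y0]]] := skew_diag sY; have [Q uQ [w [dW w0]]] := skew_diag sW.
have Hs (s : {perm 'I_n}) : \sum_i cim (w 0 (s i)) * cim (y 0 i) = 0.
  pose v := P^t* *m perm_mx s *m Q.
  have uv : v \is unitarymx := conj_unitary uP (perm_mx_unitary s) uQ.
  have := H v uv.
  have -> : v *m W *m v^t* *m Y =
      P^t* *m ((perm_mx s *m diag_mx w *m (perm_mx s)^t*) *m diag_mx y *m P).
    rewrite /v dW dY !trmxC_mul trmxCK.
    move: (perm_mx s : 'M[C]_n) => s2.
    move: (P^t*) (Q^t*) (s2^t*) (unit_mulV uP) (unit_mulV uQ) => P1 Q1 s1 PP QQ.
    by rewrite !mulmxA -(mulmxA _ Q Q1) QQ mulmx1 -(mulmxA _ Q Q1) QQ mulmx1 -(mulmxA _ P P1) PP mulmx1.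
  rewrite rtrC -mulmxA unit_mulV// mulmx1 rtr.unlock mul_mx_diag /mxtrace cre_sum => h.
  apply/eqP; rewrite -oppr_eq0 -sumrN -{2}h; apply/eqP/eq_bigr => i _.
  by rewrite mxE perm_conj mxE eqxx mulr1n creM w0 mul0r sub0r.
have cst (z : 'rV[C]_n) (i j : 'I_n) : (forall i, cre (z 0 i) = 0) ->
    cim (z 0 i) = cim (z 0 j) -> z 0 i = z 0 j.
  move=> z0 e; apply/eqP; rewrite eq_complex; apply/andP; split; apply/eqP => //.
  by rewrite -!/(cre _) !z0.
have [ya|] := pselect (forall i, cim (y 0 i) = cim (y 0 0)).
  by left; apply: (diag_const_eq0 (i := 0) dY uP tY) => k; exact: cst.
move=> /existsNP[i yi]; right.
have i0 : i != 0 by apply: contra_not_neq yi => ->.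
apply: (diag_const_eq0 (i := 0) dW uQ tW) => k; apply: cst => //.
apply: (@const_of_perm _ (fun i => cim (w 0 i)) i 0 i0) => s.
(* The sums for [s] and for [s] preceded by a transposition differ only at [i] and 0. Subtracting
   them leaves the product of two differences, one of [w] and one of [y]; the latter is nonzero by
   the choice of [i]. *)
have := Hs s; have := Hs (tperm i 0 * s)%g.
rewrite (bigD1 i)//= (bigD1 0) 1?eq_sym//= [X in _ -> X = _ -> _](bigD1 i)//= [X in _ -> _ + X = _ -> _](bigD1 0) 1?eq_sym//=.
rewrite !permM tpermL tpermR.
rewrite (eq_bigr (fun j => cim (w 0 (s j)) * cim (y 0 j))) => [|j /andP[ji j0]]; last first.
  by rewrite permM tpermD// eq_sym.
move: (\sum_(_ | _) _) => S e1 e2.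
have : (cim (w 0 (s i)) - cim (w 0 (s 0))) * (cim (y 0 i) - cim (y 0 0)) = 0.
  by move: e1 e2; move: (cim _) (cim _) (cim _) (cim _) => a b c d' e1 e2; lra.
by move=> /eqP; rewrite mulf_eq0 !subr_eq0 => /orP[/eqP//|/eqP].
Qed.
End AdjointPairing.

(** * Sufficiently dense closed subgroups of SU(n) are open *)

Section DenseImpliesOpen.
Variables (R : realType) (m : nat).
Local Notation C := (Cplx R).
Local Notation n := (2 + m)%N.
Local Notation SUmx := (@special_unitary R n).
Implicit Types (J : set 'M[C]_n) (Y W g h : 'M[C]_n).

Lemma phase_neq1 k : phase m (pi / k.+1%:R : R) != 1%:M.
Proof.
apply: contra_neq (phase_pi_neq1 R m) => h.
have := phase_pow m (pi / k.+1%:R : R) k.+1.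
by rewrite h expr1n mulrC divfK// pnatr_eq0.
Qed.

(* As in Jordan's theorem: if 1 were isolated in J, an element g closest to 1
   would commute with all elements of J near 1. *)
Lemma near_minimal_commutes J : ugroup J ->
  (exists2 k, J k & k != 1%:M) ->
  (exists2 r, 0 < r & forall k, J k -> k != 1%:M -> r <= nrm (k - 1%:M)) ->
  forall k0, J k0 -> k0 != 1%:M ->
  exists g, [/\ J g, g != 1%:M, nrm (g - 1%:M) <= 2 * nrm (k0 - 1%:M) &
    forall h, J h -> nrm (h - 1%:M) < 4^-1 -> g *m h = h *m g].
Proof.
move=> [Ju J1 JM JV] [k Jk k1] [r r0 H] k0 Jk0 k01.
pose S := [set nrm (k - 1%:M) | k in J `&` [set k | k != 1%:M]].
have iS : has_inf S.
  by split; [exists (nrm (k - 1%:M)), k|exists r => _ [l [Jl l1] <-]; exact: H].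
have rS : r <= inf S by apply: lb_le_inf; [exact: iS.1|move=> _ [l [Jl l1] <-]; exact: H].
have s0 : 0 < inf S by exact: lt_le_trans rS.
have [_ [g [Jg g1] <-] gS] := inf_adherent s0 iS.
have Sl l : J l -> l != 1%:M -> inf S <= nrm (l - 1%:M).
  by move=> Jl l1; apply: ge_inf; [exact: iS.2|exists l].
exists g; split=> //; first by have := Sl _ Jk0 k01; lra.
move=> h Jh hn; have ug := Ju _ Jg; have uh := Ju _ Jh.
have cJ : J (g *m h *m g^t* *m h^t*).
  by apply: (JM); [apply: (JM); [exact: JM|exact: JV]|exact: JV].
have : g *m h *m g^t* *m h^t* = 1%:M.
  apply: contrapT => /eqP c1; have := Sl _ cJ c1; have := nrm_comm ug uh.
  have := nrm_ge0 (h - 1%:M); have := nrm_ge0 (g - 1%:M).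
  move: (nrm (_ *m _ - _)) (nrm (g - _)) (nrm (h - _)) hn gS => a b c; move: (inf S) s0 => s.
  by move=> *; nra.
move=> /(congr1 (fun A => A *m (h *m g))).
rewrite mul1mx => <-; rewrite mulmxA -(mulmxA _ (h^t*)) unit_Vmul// mulmx1.
by rewrite -(mulmxA _ (g^t*)) unit_Vmul// mulmx1.
Qed.

(** Otherwise there are discrete groups [J l] that become denser and denser. Their nearly minimal
    elements [g l] tend to 1 and commute with all elements near 1; in the limit their direction
    commutes with a neighbourhood of 1 in SU(n), hence is 0 although it has norm 1. *)
Lemma small_elements : exists2 e, 0 < e & forall J, ugroup J -> 
  (forall k, J k -> k \in SUmx) ->
  (forall g, g \in SUmx -> exists2 h, J h & nrm (g - h) < e) ->
  forall r, 0 < r -> exists k, [/\ J k, k != 1%:M & nrm (k - 1%:M) < r].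
Proof.
apply: contrapT => H.
pose u l : 'M[C]_n := phase m (pi / l.+1%:R : R).
pose t l := nrm (u l - 1%:M).
have t0 l : 0 < t l by rewrite nrm_gt0// subr_eq0 phase_neq1.
have /choice[J JP] : forall l : nat, exists J, [/\ ugroup J, (forall k, J k -> k \in SUmx),
    (* The bound [t l] keeps an approximation of [u l] different from 1, while [l.+1%:R^-1] makes
       the groups dense in the limit. *)
    (forall g, g \in SUmx -> exists2 h, J h & nrm (g - h) < Num.min (t l) l.+1%:R^-1) &
    exists2 r, 0 < r & forall k, J k -> k != 1%:M -> r <= nrm (k - 1%:M)].
  move=> l; apply: contrapT => Hl; apply: H.
  exists (Num.min (t l) l.+1%:R^-1); first by rewrite lt_min t0/=.
  move=> J gJ JS dJ r r0; apply: contrapT => Hr; apply: Hl; exists J; split=> //.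
  exists r => // k Jk k1; rewrite leNgt; apply/negP => kr; apply: Hr; exists k; split=> //.
have /choice[g gP] : forall l, exists g, [/\ J l g, g != 1%:M, nrm (g - 1%:M) <= 4 * t l &
    forall h, J l h -> nrm (h - 1%:M) < 4^-1 -> g *m h = h *m g].
  move=> l; have [gJ JS dJ iJ] := JP l.
  have [h Jh] := dJ (u l) (phase_SU m _); rewrite lt_min => /andP[hu _].
  have h1 : h != 1%:M by apply: contraTneq hu => ->; rewrite ltxx.
  have [g [Jg g1 gh cg]] := near_minimal_commutes gJ (ex_intro2 _ _ h Jh h1) iJ Jh h1.
  exists g; split=> //; apply: le_trans gh _.
  have := nrm_trans (u l) h 1%:M; rewrite -/(t l) (nrmBC h (u l)); move: hu.
  move: (nrm (u l - h)) (nrm (h - 1%:M)) (t l) => a b c *; lra.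
have Jg l : J l (g l) by have [] := gP l.
have g1 l : g l != 1%:M by have [] := gP l.
have sg l : g l \in SUmx by have [_ JS _ _] := JP l; exact: JS.
have cg : mcvg g 1%:M.
  apply: (@mcvg_squeeze _ _ _ _ _ (fun l => 4 * t l)) => [l|]; first by have [] := gP l.
  rewrite -[X in _ --> X](mulr0 4); apply: cvgM; [exact: cvg_cst|exact: mcvg_phase].
have [phi hphi [Y [Y1 sY tY] cY]] := direction_su sg g1 cg.
have : Y = 0; last first.
  by move=> Y0; move: Y1; rewrite Y0 nrm0 => /eqP; rewrite eq_sym oner_eq0.
apply: (@commutes_small_SU R m Y 4^-1) => //.
move=> h sh hn.
have /choice[k kP] : forall l, exists k, J l k /\ nrm (h - k) < l.+1%:R^-1.
  move=> l; have [_ _ dJ _] := JP l; have [k Jk] := dJ h sh.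
  by rewrite lt_min => /andP[_ hk]; exists k.
have ck : mcvg (k \o phi) h.
  apply: mcvg_sub hphi _; apply: (mcvg_squeeze _ (@cvg_invS R)) => l.
  by rewrite nrmBC ltW//; have [] := kP l.
have c1 : mcvg (fun l => dir (g (phi l)) *m k (phi l)) (Y *m h) by exact: mcvgM cY ck.
have c2 : mcvg (fun l => k (phi l) *m dir (g (phi l))) (h *m Y) by exact: mcvgM ck cY.
have [N HN] := mcvg_nearby ck (e := 4^-1 - nrm (h - 1%:M)) ltac:(by rewrite subr_gt0).
have sN : subsequence (fun i => i + N)%N by move=> i; rewrite addSn.
apply: (mcvg_unique (mcvg_sub sN c1)); apply: mcvg_eq (mcvg_sub sN c2) => i /=.
set l := phi _.
have comm : g l *m k l = k l *m g l.
  have [_ _ _ cl] := gP l; apply: cl; first by have [] := kP l.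
  have := HN (i + N)%N (leq_addl _ _); rewrite /= -/l.
  have := nrm_trans h (k l) 1%:M; move: (nrm _) (nrm _) (nrm _) => a b c; lra.
by rewrite dir_def -scalemxAl -scalemxAr mulmxBl mulmxBr mul1mx mulmx1 comm.
Qed.

(** The uniform form of [trace_pairing_unitary], by compactness of the unit sphere of su(n);
    [unitary_scale_SU] replaces unitary conjugators by special ones. *)
Lemma trace_pairing_bound : exists2 c : R, 0 < c & forall Y W, in_su Y -> in_su W ->
  exists2 g, g \in SUmx & c < `|rtr (g *m W *m g^t* *m Y)|.
Proof.
apply: contrapT => H.
have /choice[YW YWP] : forall l : nat, exists YW : 'M[C]_n * 'M[C]_n, [/\ in_su YW.1, in_su YW.2 &
    forall g, g \in SUmx -> `|rtr (g *m YW.2 *m g^t* *m YW.1)| <= l.+1%:R^-1].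
  move=> l; apply: contrapT => Hl; apply: H; exists l.+1%:R^-1 => // Y W sY sW.
  apply: contrapT => Hg; apply: Hl; exists (Y, W); split=> // g sg.
  by rewrite leNgt; apply/negP => h; apply: Hg; exists g.
have [l|phi hphi [Y [Y1 sY tY] cY]] := @in_su_limit _ _ (fun l => (YW l).1).
  by have [] := YWP l.
have [l|psi hpsi [W [W1 sW tW] cW]] := @in_su_limit _ _ (fun l => (YW (phi l)).2).
  by have [] := YWP (phi l).
have cY' := mcvg_sub hpsi cY.
have [] : Y = 0 \/ W = 0.
- apply: trace_pairing_unitary => // v uv.
  have [g sg gv] := unitary_scale_SU (ltn0Sn _) uv; rewrite -gv.
  have c := mcvg_rtr (mcvgM (mcvgM (mcvgM (mcvg_cst g) cW) (mcvg_cst (g^t*))) cY').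
  apply: (cvg_unique _ c) => //; apply/norm_cvg0P.
  have h := subsequence_comp hphi hpsi.
  apply: (@cvg0_squeeze _ _ (fun l => (phi (psi l)).+1%:R^-1)) => [l|].
    rewrite normr_ge0/=; have [_ _] := YWP (phi (psi l)); exact.
  exact: (cvg_subsequence h (@cvg_invS R)).
- by move=> Y0; move: Y1; rewrite Y0 nrm0 => /eqP; rewrite eq_sym oner_eq0.
- by move=> W0; move: W1; rewrite W0 nrm0 => /eqP; rewrite eq_sym oner_eq0.
Qed.

Lemma dense_subgroup_SU : exists2 e, 0 < e & forall J, ugroup J -> seqcompact J ->
  (forall k, J k -> k \in SUmx) ->
  (forall g, g \in SUmx -> exists2 h, J h & nrm (g - h) < e) ->
  exists2 r, 0 < r & forall g, g \in SUmx -> nrm (g - 1%:M) < r -> J g.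
Proof.
have [e1 e10 H1] := small_elements; have [c c0 H2] := trace_pairing_bound.
(* [e1] provides a tangent direction [W]. Replacing a conjugator [g] by a nearby [h] in [J] changes
   the pairing by at most [2 * nrm (g - h) < c / 2], whereas the pairing vanishes for [h] and
   exceeds [c] in absolute value for [g]. *)
exists (Num.min e1 (c / 4)); first by rewrite lt_min e10 divr_gt0.
move=> J gJ cJ JS dJ; apply: contrapT => nJ.
have [Y suY HY] := normal_direction gJ cJ JS nJ.
have [|W suW tW] := tangent_su gJ JS.
  apply: H1 => // g /dJ[h Jh]; rewrite lt_min => /andP[gh _]; by exists h.
have [g sg] := H2 _ _ suY suW.
have [h Jh] := dJ g sg; rewrite lt_min => /andP[_ gh].
have [_ sW _] := suW; have [Y1 _ _] := suY; have [W1 _ _] := suW.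
have h0 : rtr (h *m W *m h^t* *m Y) = 0.
  apply: HY; first exact: tangent_conj.
  by rewrite /skewherm !trmxC_mul trmxCK sW mulNmx mulmxN mulmxA.
have uh := SU_unitary (JS _ Jh); have ug := SU_unitary sg.
rewrite -[rtr _]subr0 -h0 -rtrB -mulmxBl => /lt_le_trans/(_ (rtrM_le _ _)).
rewrite Y1 mulr1.
have -> : g *m W *m g^t* - h *m W *m h^t* = (g - h) *m W *m g^t* + h *m W *m (g - h)^t*.
  by rewrite trmxC_add trmxC_opp mulmxBr !mulmxBl addrA subrK.
have l1 : nrm ((g - h) *m W *m g^t*) <= nrm (g - h).
  by rewrite nrmUr ?trmxC_unitary// -[leRHS]mulr1 -W1 nrmM.
have l2 : nrm (h *m W *m (g - h)^t*) <= nrm (g - h).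
  by rewrite -mulmxA nrmUl// -[leRHS]mul1r -W1 -[in leRHS](nrm_adj (g - h)) nrmM.
have := nrmD ((g - h) *m W *m g^t*) (h *m W *m (g - h)^t*).
move: l1 l2 gh; move: (nrm ((g - h) *m W *m g^t*)) (nrm (h *m W *m (g - h)^t*)) => a b.
by move: (nrm (_ + _)) (nrm (g - h)) => x y *; lra.
Qed.
End DenseImpliesOpen.

(** * Subgroups of the product *)

Section SUTopology.
Variables (R : realType) (n : nat).
Local Notation C := (Cplx R).
Local Notation SUn := (SU R n).

Lemma SUval_SU (x : SUn) : SUval x \in @special_unitary R n.
Proof. by case: x. Qed.

Lemma SUval_unitary (x : SUn) : SUval x \is unitarymx.
Proof. exact/SU_unitary/SUval_SU. Qed.

Lemma SUval_inj : injective (@SUval R n). Proof. exact: val_inj. Qed.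

Lemma SUval1 : SUval (1%g : SUn) = 1%:M. Proof. by []. Qed.
Lemma SUvalM (x y : SUn) : SUval (x * y)%g = SUval x *m SUval y. Proof. by []. Qed.
Lemma SUvalV (x : SUn) : SUval x^-1%g = (SUval x)^t*.
Proof. by rewrite -(invmx_unitary (SUval_unitary x)). Qed.

Lemma SUval_pow (x : SUn) k : SUval (x ^+ k)%g = SUval x ^+ k.
Proof. by elim: k => [|k IH]; rewrite ?expgS ?exprS// SUvalM IH. Qed.

Lemma norm_Cplx (z : C) : `|z| = rc (nc z).
Proof. by case: z => a b; exact: normc_def. Qed.

Lemma nc_le (z : C) : nc z <= `|cre z| + `|cim z|.
Proof.
rewrite /nc -[leRHS]ger0_norm ?addr_ge0// -sqrtr_sqr ler_sqrt ?sqr_ge0//.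
by rewrite /csq sqrrD !real_normK ?num_real// addrAC lerDl mulrn_wge0// mulr_ge0.
Qed.

Lemma nrm_lt_entries (A : 'M[C]_n) (e : R) : 0 < e ->
  (forall i j, nc (A i j) < e / n.+1%:R) -> nrm A < e.
Proof.
move=> e0 h; have n0 : 0 < n.+1%:R :> R by [].
have en : 0 < e / n.+1%:R by rewrite divr_gt0.
rewrite nrmE -(ger0_norm (ltW e0)) -sqrtr_sqr ltr_sqrt ?exprn_gt0// nsqE.
apply: (@le_lt_trans _ _ (\sum_(i < n) \sum_(j < n) (e / n.+1%:R) ^+ 2)).
  apply: ler_sum => i _; apply: ler_sum => j _.
  rewrite -[leLHS]sqr_sqrtr ?csq_ge0// lerXn2r ?nnegrE ?sqrtr_ge0 ?(ltW en)//.
  exact/ltW/h.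
rewrite !sumr_const !card_ord -mulrnA -[ltLHS]mulr_natl natrM exprMn mulrCA.
rewrite -[ltRHS]mulr1 ltr_pM2l ?exprn_gt0// exprVn ltr_pdivrMr ?exprn_gt0// mul1r.
by rewrite -expr2 ltrXn2r// ?ltr_nat// ?ler0n.
Qed.

Lemma nbhs_matrix_nrm (A : 'M[C]_n) (e : R) : 0 < e -> nbhs A [set B | nrm (A - B) < e].
Proof.
move=> e0; have en : 0 < rc (e / n.+1%:R) :> C.
  by rewrite ltcR divr_gt0.
apply/nbhs_ballP; exists (rc (e / n.+1%:R)) => // B [_ AB].
apply: nrm_lt_entries => // i j; have := AB i j.
by rewrite /ball /= /ball_ norm_Cplx ltcR !mxE.
Qed.

Lemma nbhs_SU_nrm (x : SUn) (e : R) : 0 < e ->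
  nbhs x [set y | nrm (SUval x - SUval y) < e].
Proof.
move=> e0; have := @initial_continuous _ _ (@SUval R n) x.
by move=> /(_ _ (nbhs_matrix_nrm (SUval x) e0)).
Qed.

Lemma nbhs_SU_sub (x : SUn) (A : set SUn) : nbhs x A ->
  exists2 e : R, 0 < e & forall y, nrm (SUval x - SUval y) < e -> A y.
Proof.
rewrite (@nbhsE (initial_topology (@SUval R n))) => -[_ [[U oU <-] Ux]] UA.
have /nbhs_ballP[e /= e0 eU] : nbhs (SUval x) U by apply: open_nbhs_nbhs.
have eR : rc (cre e) = e.
  by apply/eqP; rewrite eq_complex /= eqxx/=; move: e0; case: (e) => a b /andP[/eqP <- _].
have e0' : 0 < cre e by move: e0; rewrite -{1}eR ltcR.
exists (cre e) => // y xy; apply/UA/eU; split => // i j.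
rewrite /ball /= /ball_ norm_Cplx -eR ltcR.
apply: le_lt_trans xy; rewrite nrmE ler_sqrt ?nsq_ge0//.
by have := csq_le_nsq (SUval x - SUval y) i j; rewrite !mxE.
Qed.

(** For the determinant, [(u i)^t* *m A] is unitary, has determinant [\det A] and tends to 1, where
    [nc_tr_det_unit1] controls determinants. *)
Lemma limit_SU (u : nat -> 'M[C]_n) A : (forall i, u i \in @special_unitary R n) ->
  mcvg u A -> A \in @special_unitary R n.
Proof.
move=> su cu; have uu i := SU_unitary (su i).
have uA : A \is unitarymx.
  apply/unitarymxP; apply: (mcvg_unique (mcvgM cu (mcvg_adj cu))).
  by apply: mcvg_eq (mcvg_cst 1%:M) => i; rewrite unit_mulV.
rewrite inE; apply/andP; split=> //.
pose v i := (u i)^t* *m A.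
have uv i : v i \is unitarymx by apply: mul_unitarymx uA; rewrite trmxC_unitary.
have dv i : \det (v i) = \det A.
  by rewrite det_mulmx -map_trmx det_tr det_map_mx (SU_det (su i)) rmorph1 mul1r.
have cv : mcvg v 1%:M.
  by rewrite -(unit_Vmul uA); apply: mcvgM; [exact: mcvg_adj|exact: mcvg_cst].
suff : nc (\det A - 1) = 0.
  move=> /eqP; rewrite sqrtr_eq0 => h.
  rewrite -subr_eq0; apply/eqP/csq_eq0/eqP.
  by rewrite eq_le h csq_ge0.
apply/eqP; rewrite eq_le nc_ge0 andbT.
have c0 : (fun i => n%:R * nrm (v i - 1%:M)) @ \oo --> (0 : R).
  by rewrite -[X in _ --> X](mulr0 n%:R); apply: cvgM => //; exact: cvg_cst.
rewrite -(cvg_lim _ c0)//; apply: limr_ge; first by apply/cvg_ex; exists 0.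
by apply: nearW => i; have [+ _] := nc_tr_det_unit1 (uv i); rewrite dv.
Qed.

Lemma compact_SU : compact [set: SUn].
Proof.
rewrite compact_ultra => F UF _.
(* Bounded real functions converge along an ultrafilter: they have a cluster value, and the
   ultrafilter contains the preimage of each neighbourhood of it or the complement. This is applied
   to the real and imaginary parts of the entries. *)
have lim (f : SUn -> R) : (forall x, `|f x| <= 1) -> exists l : R, f @ F --> l.
  move=> f1; have [|l [_ fl]] := @segment_compact R (-1) 1 (f @ F) _.
    change (F (f @^-1` [set` `[(-1 : R), 1]])).
    by apply: filterE => x; rewrite /= in_itv /= -ler_norml; exact: f1.
  exists l => V Vl; have [//|FV] := in_ultra_setVsetC (f @^-1` V) UF.
  by have [x []] := fl (~` V) V FV Vl.
have c1 (x : SUn) i j : csq (SUval x i j) <= 1.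
  have /unit_mulV/matrixP/(_ i i) := SUval_unitary x; rewrite !mxE eqxx => h.
  have := congr1 (@cre R) h; rewrite cre_sum [RHS](_ : _ = 1)// => <-.
  rewrite (bigD1 j)//= !mxE cre_mulC lerDl; apply: sumr_ge0 => k _.
  by rewrite !mxE cre_mulC csq_ge0.
have /choice[re reP] : forall ij : 'I_n * 'I_n, exists l : R,
    (fun x : SUn => cre (SUval x ij.1 ij.2)) @ F --> l.
  move=> ij; apply: lim => x; rewrite -[leRHS]sqrtr1; apply: le_trans (cre_le_nc _) _.
  by rewrite ler_sqrt.
have /choice[im imP] : forall ij : 'I_n * 'I_n, exists l : R,
    (fun x : SUn => cim (SUval x ij.1 ij.2)) @ F --> l.
  move=> ij; apply: lim => x; rewrite -[leRHS]sqrtr1 -sqrtr_sqr ler_sqrt//.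
  by apply: le_trans (c1 x ij.1 ij.2); rewrite lerDr sqr_ge0.
pose A : 'M[C]_n := \matrix_(i, j) Complex (re (i, j)) (im (i, j)).
have FA e : 0 < e -> F [set x | nrm (A - SUval x) < e].
  move=> e0; have e2 : 0 < e / n.+1%:R / 2 by rewrite !divr_gt0.
  have H (ij : 'I_n * 'I_n) : F [set x | nc (A ij.1 ij.2 - SUval x ij.1 ij.2) < e / n.+1%:R].
    move/cvgrPdist_lt : (reP ij) => /(_ _ e2); move/cvgrPdist_lt : (imP ij) => /(_ _ e2).
    apply: filterS2 => x /=; rewrite mxE; case: ij => i j /=.
    case: (SUval x i j) => a b /= h1 h2.
    rewrite [ltRHS]splitr; apply: le_lt_trans (nc_le _) _.
    exact: (ltrD h2 h1).
  have FH := @filter_forall _ _ (fun (ij : 'I_n * 'I_n) (x : SUn) =>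
    nc (A ij.1 ij.2 - SUval x ij.1 ij.2) < e / n.+1%:R) F _ H.
  apply: filterS (FH _) => x h.
  apply: nrm_lt_entries => // i j.
  by have := h (i, j); rewrite !mxE.
have /choice[u uP] : forall i : nat, exists x, nrm (A - SUval x) < i.+1%:R^-1.
  by move=> i; have /filter_ex[x] := FA i.+1%:R^-1 ltac:(by []); exists x.
have sA : A \in @special_unitary R n.
  apply: (@limit_SU (fun i => SUval (u i))) => [i|]; first exact: SUval_SU.
  by apply: (mcvg_squeeze _ (@cvg_invS R)) => i; rewrite nrmBC ltW.
exists (MkSU sA); split=> // B /nbhs_SU_sub[e e0 eB].
by apply: filterS (FA e e0) => x; exact: eB.
Qed.

Variable d : biinvariant_metric R n.

(** Both distances are left invariant, so the comparison at 1 is uniform in [x]. *)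
Lemma bm_dist_nrm (e : R) : 0 < e -> exists2 r, 0 < r &
  forall x y : SUn, d x y < r -> nrm (SUval x - SUval y) < e.
Proof.
move=> e0; have /(bm_nbhs d)[r r0 rH] := nbhs_SU_nrm (1%g : SUn) e0.
exists r => // x y xy.
have ux := SUval_unitary x.
have -> : SUval x - SUval y = SUval x *m (SUval 1%g - SUval (x^-1 * y)%g).
  by rewrite SUvalM SUvalV SUval1 mulmxBr mulmx1 mulmxA unit_mulV// mul1mx.
by rewrite nrmUl//; apply: rH; rewrite /= -(bm_invl d x) mulg1 mulVKg.
Qed.

Lemma bm_distM x y x' y' : d (x * y)%g (x' * y')%g <= d x x' + d y y'.
Proof.
by rewrite (le_trans (bm_triangle d (x' * y)%g _ _))// bm_invr bm_invl.
Qed.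

Lemma bm_dist_pow x y k : d (x ^+ k)%g (y ^+ k)%g <= k%:R * d x y.
Proof.
elim: k => [|k IH]; first by rewrite !expg0 bm_xx mul0r.
rewrite !expgS -natr1 mulrDl mul1r addrC.
by rewrite (le_trans (bm_distM _ _ _ _))// lerD2l.
Qed.
End SUTopology.

(** * Coordinates, Hausdorff distance and elements of infinite order *)

Section ProductGroups.
Variables (R : realType) (d : forall n, biinvariant_metric R n.+1).
Local Notation SUp := (SUprod d).
Implicit Types (x y g : SUp) (G H : compact_subgroup d).

Lemma SUprod_powE x k n : (x ^+ k)%g n = (x n ^+ k)%g.
Proof. by elim: k => [|k IH]; rewrite ?expg0// !expgS -IH. Qed.

Lemma mdistE x y : mdist x y = SUprod_dist x y. Proof. by []. Qed.

Lemma coord_dist x y n : d n (x n) (y n) <= 2 ^+ n.+1 * mdist x y.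
Proof.
have := SUprod_term_le_dist x y n; rewrite -mdistE /SUprod_term.
by rewrite ler_pdivrMl ?exprn_gt0.
Qed.

(** Biinvariance makes the [k]-th power map [k]-Lipschitz, and one coordinate distance is at most
    [2 ^+ n.+1] times the product distance. *)
Lemma pow_neq1_dist x y n k : (0 < k)%N -> (x n ^+ k)%g != 1%g ->
  mdist x y * (k%:R * 2 ^+ n.+1) < d n (x n ^+ k)%g 1%g -> (y ^+ k)%g <> 1%g.
Proof.
move=> k0 xk xy yk; have := bm_dist_pow (d n) (x n) (y n) k.
rewrite -[in X in X <= _](SUprod_powE y) yk leNgt => /negP; apply.
apply: le_lt_trans xy; rewrite [leRHS]mulrC -mulrA ler_wpM2l//.
exact: coord_dist.
Qed.

Lemma bm_gt0 n (a b : SU R n.+1) : a != b -> 0 < d n a b.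
Proof.
move=> ab; rewrite lt_neqAle bm_ge0 andbT eq_sym; apply: contra_neq ab.
exact: bm_positivity.
Qed.

Lemma pow_neq1_open x k : (0 < k)%N -> (x ^+ k)%g <> 1%g ->
  exists2 r, 0 < r & forall y, mdist x y <= r -> (y ^+ k)%g <> 1%g.
Proof.
move=> k0 xk; have [n xn] : exists n, (x n ^+ k)%g != 1%g.
  apply: contrapT => H; apply: xk; apply: functional_extensionality_dep => n.
  by rewrite SUprod_powE; apply: contrapT => h; apply: H; exists n; apply/eqP.
have c0 := bm_gt0 xn; set c := d n _ _ in c0.
have K0 : 0 < k%:R * 2 ^+ n.+1 :> R by rewrite mulr_gt0 ?exprn_gt0// ltr0n.
exists (c / 2 / (k%:R * 2 ^+ n.+1)); first by rewrite !divr_gt0.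
move=> y xy; apply: (pow_neq1_dist k0 xn).
apply: (@le_lt_trans _ _ (c / 2)); first by rewrite -ler_pdivlMr.
by rewrite ltr_pdivrMr// ltr_pMr// ltr1n.
Qed.

Lemma cvg_coord (u : nat -> SUp) x n : u @ \oo --> x ->
  mcvg (fun i => SUval (u i n)) (SUval (x n)).
Proof.
move=> ux; apply/cvgrPdist_lt => e /(bm_dist_nrm (d n))[r r0 rH].
have r0' : 0 < r / 2 ^+ n.+1 by rewrite divr_gt0// exprn_gt0.
have [M _ HM] := ux _ (nbhsx_ballx x _ r0').
exists M => // i /HM; rewrite /= ballEmdist /= => xi.
rewrite sub0r normrN ger0_norm ?nrm_ge0// nrmBC; apply: rH.
apply: le_lt_trans (coord_dist _ _ _) _.
by rewrite mulrC -ltr_pdivlMr ?exprn_gt0.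
Qed.

Lemma cvg_SUprod (T : Type) (F : set_system T) (f : T -> SUp) x : Filter F ->
  (forall n, (fun t => f t n) @ F --> x n) -> f @ F --> x.
Proof.
move=> FF fx; suff : f @ F --> (x : prod_topology (fun n => SU R n.+1)) by [].
apply/cvg_sup => n B.
rewrite (@nbhsE (initial_topology _)) => -[_ [[U oU <-] Ux]] UB.
have h := fx n U (open_nbhs_nbhs (conj oU Ux)).
by apply: (@filterS _ F FF _ _ _ h) => t; exact: UB.
Qed.

Lemma hausdorff_near G H e : mdist G H < e ->
  forall x, subgroup_set G x -> exists2 y, subgroup_set H y & mdist x y < e.
Proof.
move=> GH x Gx; have e0 : 0 < e - mdist G H by rewrite subr_gt0.
have [|_ [y Hy <-] h] := @inf_adherent R [set mdist x y | y in subgroup_set H] _ e0.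
  split; first by have [y Hy] := subgroup_neq0 H; exists (mdist x y), y.
  by exists 0 => _ [y _ <-]; exact: mdist_ge0.
exists y => //; apply: lt_le_trans h _.
have := dist_to_set_hausdorff (@SUprod_dist_le1 R d) (subgroup_neq0 H) Gx.
rewrite /dist_to_set -/(subgroup_dist G H) -[subgroup_dist G H]/(mdist G H).
by move=> h; lra.
Qed.

Lemma hausdorff_le G H e :
  (forall x, subgroup_set G x -> exists2 y, subgroup_set H y & mdist x y <= e) ->
  (forall y, subgroup_set H y -> exists2 x, subgroup_set G x & mdist y x <= e) ->
  mdist G H <= e.
Proof.
move=> h1 h2; rewrite -[mdist G H]/(hausdorff_dist G H) /hausdorff_dist ge_max.
apply/andP; split; apply: ge_sup.
- by have [x Gx] := subgroup_neq0 G; exists (dist_to_set x H), x.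
- move=> _ [x /h1[y Hy xy] <-]; exact: le_trans (dist_to_set_le x Hy) xy.
- by have [x Hx] := subgroup_neq0 H; exists (dist_to_set x G), x.
- move=> _ [y /h2[x Gx xy] <-]; exact: le_trans (dist_to_set_le y Gx) xy.
Qed.

Section WithCoord.
Variable N : nat.

Definition truncate x : SUp := fun i => if (i < N)%N then x i else 1%g.
Definition with_coord x (u : SU R N.+1) : SUp := dfwith (truncate x) N u.

Lemma with_coordN x u : with_coord x u N = u.
Proof. exact: dfwithin. Qed.

Lemma with_coord_lt x u i : (i < N)%N -> with_coord x u i = x i.
Proof. by move=> iN; rewrite /with_coord dfwithout ?gtn_eqF// /truncate iN. Qed.

Lemma with_coord_gt x u i : (N < i)%N -> with_coord x u i = 1%g.
Proof.
by move=> iN; rewrite /with_coord dfwithout ?ltn_eqF// /truncate ltnNge ltnW.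
Qed.

Lemma with_coordP x u y : (forall i, (i < N)%N -> y i = x i) -> y N = u ->
  (forall i, (N < i)%N -> y i = 1%g) -> y = with_coord x u.
Proof.
move=> h1 h2 h3; apply: functional_extensionality_dep => i.
case: (ltngtP i N) => iN.
- by rewrite with_coord_lt// h1.
- by rewrite with_coord_gt// h3.
- by rewrite iN with_coordN.
Qed.

Lemma with_coordM x u y v : (with_coord x u * with_coord y v)%g = with_coord (x * y)%g (u * v)%g.
Proof.
apply: with_coordP => [i iN||i iN].
- by rewrite -[LHS]/(with_coord x u i * with_coord y v i)%g !with_coord_lt.
- by rewrite -[LHS]/(with_coord x u N * with_coord y v N)%g !with_coordN.
- by rewrite -[LHS]/(with_coord x u i * with_coord y v i)%g !with_coord_gt// mulg1.
Qed.

Lemma with_coordV x u : ((with_coord x u)^-1)%g = with_coord (x^-1)%g (u^-1)%g.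
Proof.
apply: with_coordP => [i iN||i iN].
- by rewrite -[LHS]/((with_coord x u i)^-1)%g !with_coord_lt.
- by rewrite -[LHS]/((with_coord x u N)^-1)%g !with_coordN.
- by rewrite -[LHS]/((with_coord x u i)^-1)%g !with_coord_gt// invg1.
Qed.

Lemma with_coord_continuous :
  continuous (fun z : SUp * SU R N.+1 => with_coord z.1 z.2).
Proof.
move=> z; apply: cvg_SUprod => i; case: (ltngtP i N) => iN.
- rewrite with_coord_lt// (_ : (fun t => _) = fun t : SUp * SU R N.+1 => t.1 i).
    apply: (@cvg_comp _ _ _ fst (fun x : SUp => x i) _ (nbhs z.1)); first exact: cvg_fst.
    exact: (@proj_continuous nat (fun n => SU R n.+1) i z.1).
  by apply/funext => t; rewrite with_coord_lt.
- rewrite with_coord_gt// (_ : (fun t => _) = fun=> 1%g); first exact: cvg_cst.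
  by apply/funext => t; rewrite with_coord_gt.
- subst i; rewrite with_coordN (_ : (fun t => _) = snd); first exact: cvg_snd.
  by apply/funext => t; rewrite with_coordN.
Qed.

Lemma with_coord_dist x u y v : (forall i, (i < N)%N -> x i = y i) ->
  mdist (with_coord x u) (with_coord y v) <= 2 ^- N.
Proof.
move=> xy; rewrite -[leRHS]add0r; apply: SUprod_dist_bound => // n nN.
by rewrite !with_coord_lt// xy// bm_xx.
Qed.

Lemma dist_with_coord x u : mdist x (with_coord x u) <= 2 ^- N.
Proof.
rewrite -[leRHS]add0r; apply: SUprod_dist_bound => // n nN.
by rewrite with_coord_lt// bm_xx.
Qed.

(* p_N(G) x SU(N+1) x 1 x 1 x ..., where p_N is the projection to the first N
   factors. *)
Section CoordGroup.
Variable G : compact_subgroup d.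

Definition coord_set : set SUp :=
  (fun z => with_coord z.1 z.2) @` (subgroup_set G `*` [set: SU R N.+1]).

Lemma coord_set_in x u : subgroup_set G x -> coord_set (with_coord x u).
Proof. by move=> Gx; exists (x, u). Qed.

Lemma coord_set_neq0 : coord_set !=set0.
Proof. by have [x Gx] := subgroup_neq0 G; exists (with_coord x 1%g); exact: coord_set_in. Qed.

Lemma coord_setM x y : coord_set x -> coord_set y -> coord_set (x * y)%g.
Proof.
move=> [[a u] [/= Ga _] <-] [[b v] [/= Gb _] <-]; rewrite with_coordM.
exact/coord_set_in/subgroup_mul.
Qed.

Lemma coord_setV x : coord_set x -> coord_set x^-1%g.
Proof.
move=> [[a u] [/= Ga _] <-]; rewrite with_coordV.
exact/coord_set_in/subgroup_inv.
Qed.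

Lemma coord_set_compact : compact coord_set.
Proof.
apply: continuous_compact; first exact/continuous_subspaceT/with_coord_continuous.
by apply: compact_setX; [exact: subgroup_compact|exact: compact_SU].
Qed.

Definition coord_group : compact_subgroup d :=
  CompactSubgroup coord_set_neq0 coord_setM coord_setV coord_set_compact.

Lemma coord_group_dist : mdist G coord_group <= 2 ^- N.
Proof.
apply: hausdorff_le => [x Gx|_ [[x u] [/= Gx _] <-]].
  by exists (with_coord x 1%g); [exact: coord_set_in|exact: dist_with_coord].
by exists x => //; rewrite metric_sym dist_with_coord.
Qed.
End CoordGroup.
End WithCoord.

Lemma pow2_lt (e : R) : 0 < e -> exists m : nat, (2 : R) ^- m.+1 < e.
Proof.
move=> /invS_lt[N /(_ N (leqnn N)) h]; exists N; apply: le_lt_trans h.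
rewrite lef_pV2 ?posrE ?exprn_gt0// -natrX ler_nat.
exact: ltnW (ltn_expl _ _).
Qed.

(** An element of the factor of index [m.+1] in the product, which is SU(m+2). *)
Definition phaseSU m (t : R) : SU R m.+2 := MkSU (phase_SU m t).
Definition rotSU m (t : R) : SU R m.+2 := MkSU (planerot_SU m t).

Lemma phaseSU_neq1 m k : (0 < k)%N -> (phaseSU m (pi / k%:R) ^+ k)%g != 1%g.
Proof.
move=> k0; apply: contra_neq (phase_pi_neq1 R m) => /(congr1 (@SUval R _)).
by rewrite SUval_pow /= phase_pow mulrC divfK// pnatr_eq0 -lt0n.
Qed.

(** The factorial exponent excludes all orders up to [k.+1] at once, so one condition per [k]
    carries both the exponent and the scale. *)
Definition almost_nontorsion k (G : compact_subgroup d) := forall x, subgroup_set G x ->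
  exists g, [/\ subgroup_set G g, mdist x g < k.+1%:R^-1 & (g ^+ (k.+1)`!)%g <> 1%g].

Lemma almost_nontorsion_dense k G e : 0 < e -> exists H, mdist G H < e /\
  exists2 r, 0 < r & forall G', mdist H G' < r -> almost_nontorsion k G'.
Proof.
move=> e0; pose K := (k.+1)`!; have K0 : (0 < K)%N by exact: fact_gt0.
pose b : R := k.+1%:R^-1; have b0 : 0 < b by rewrite invr_gt0.
have [|m hm] := @pow2_lt (Num.min e (b / 2)); first by rewrite lt_min e0 divr_gt0.
move: hm; rewrite lt_min => /andP[me mb].
exists (coord_group m.+1 G); split; first exact: le_lt_trans (coord_group_dist _ _) me.
pose u := phaseSU m (pi / K%:R).
have u1 : (u ^+ K)%g != 1%g by exact: phaseSU_neq1.
have c0 := @bm_gt0 m.+1 _ _ u1; set c := d m.+1 _ _ in c0.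
have K20 : 0 < K%:R * 2 ^+ m.+2 :> R by rewrite mulr_gt0 ?exprn_gt0// ltr0n.
(* Going from [G'] to the nearby group and back costs less than [b / 4] each way, and changing the
   coordinate costs less than [b / 2], in total less than [b]. The second bound preserves the
   nontrivial power [K]. *)
exists (Num.min (b / 4) (c / (K%:R * 2 ^+ m.+2))); first by rewrite lt_min !divr_gt0.
move=> G' HG' x' G'x'; have G'H := HG'; rewrite metric_sym in G'H.
have [_ [[x v] [/= Gx _] <-] xx'] := hausdorff_near G'H G'x'.
have [g' G'g' gg'] := hausdorff_near HG' (coord_set_in u Gx).
move: xx' gg'; rewrite !lt_min => /andP[xx' _] /andP[gg' gc].
exists g'; split => //.
  have h := metric_triangle x' (with_coord x v) (with_coord x u).
  apply: le_lt_trans (metric_triangle _ (with_coord x u) _) _.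
  have := @with_coord_dist m.+1 x v x u (fun _ _ => erefl).
  move: h xx' gg' mb; rewrite -/b.
  move: (mdist _ _) (mdist _ _) (mdist _ _) (mdist _ _) (2 ^- _) => *; lra.
apply: (@pow_neq1_dist (with_coord x u) g' m.+1) => //; first by rewrite with_coordN.
by rewrite with_coordN -ltr_pdivlMr.
Qed.

(** A Baire argument with nested closed balls centred in [G]: the ball of stage [k.+1] contains no
    solution of [y ^+ k.+1 = 1], and the centres accumulate at a point of [G] in all the balls. *)
Lemma nontorsion_of_almost G : (forall k, almost_nontorsion k G) ->
  exists g : SUp, subgroup_set G g /\ ~ has_finite_order g.
Proof.
move=> H.
have /choice[f fP] : forall ks : nat * (SUp * R), exists s : SUp * R,
    subgroup_set G ks.2.1 -> 0 < ks.2.2 ->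
    [/\ subgroup_set G s.1, 0 < s.2, mdist ks.2.1 s.1 + s.2 <= ks.2.2 &
      forall y, mdist s.1 y <= s.2 -> (y ^+ ks.1.+1)%g <> 1%g].
  move=> [k [x r]] /=; apply: contrapT => Hn; apply: Hn.
  have [[Gx r0]|nG] := pselect (subgroup_set G x /\ 0 < r); last first.
    by exists (x, r) => Gx r0; exfalso; exact: nG.
  have r2 : 0 < r / 2 by rewrite divr_gt0.
  have [N HN] := invS_lt r2; pose j := maxn k N.
  have [g [Gg xg gj]] := H j x Gx.
  have gk : (g ^+ k.+1)%g <> 1%g.
    move=> gk; apply: gj; have /dvdnP[q ->] : (k.+1 %| (j.+1)`!)%N.
      by rewrite dvdn_fact//= ltnS leq_maxl.
    by rewrite mulnC expgnA gk expg1n.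
  have [s s0 sH] := pow_neq1_open (ltn0Sn k) gk.
  exists (g, Num.min s (r / 2)) => _ _ /=; split => //.
  - by rewrite lt_min s0.
  - rewrite [leRHS]splitr lerD ?ge_min ?lexx ?orbT//.
    by rewrite ltW// (lt_trans xg)// HN// leq_maxr.
  - by move=> y; rewrite le_min => /andP[/sH].
have [x0 Gx0] := subgroup_neq0 G.
pose s := fix s k := if k is k'.+1 then f (k', s k') else (x0, 1 : R).
have sG k : subgroup_set G (s k).1 /\ 0 < (s k).2.
  by elim: k => //= k [Gk rk]; have [] := fP (k, s k) Gk rk.
have sS k : mdist (s k).1 (s k.+1).1 + (s k.+1).2 <= (s k).2 /\
    forall y, mdist (s k.+1).1 y <= (s k.+1).2 -> (y ^+ k.+1)%g <> 1%g.
  by have [Gk rk] := sG k; have [] := fP (k, s k) Gk rk.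
have nest k j : mdist (s k).1 (s (k + j)%N).1 + (s (k + j)%N).2 <= (s k).2.
  elim: j => [|j IH]; first by rewrite addn0 mdistxx add0r.
  rewrite addnS; have [h _] := sS (k + j)%N.
  have := metric_triangle (s k).1 (s (k + j)%N).1 (s (k + j).+1).1.
  move: h IH; move: (mdist _ _) (mdist _ _) (mdist _ _) (s _).2 (s _).2 (s _).2 => *; lra.
have [p [Gp [phi hphi cp]]] := compact_subsequence (subgroup_compact (c := G)) (fun k => (sG k).1).
exists p; split => // -[[//|k] _]; apply: (sS k).2.
apply/ler_addgt0Pr => e e0.
have [M _ HM] := cp _ (nbhsx_ballx p e e0).
have := HM (maxn M k.+1) (leq_maxl _ _); rewrite /= ballEmdist /= => pe.
set j := phi _ in pe; have kj : (k.+1 <= j)%N.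
  exact: leq_trans (leq_maxr M _) (subsequence_ge hphi _).
have := nest k.+1 (j - k.+1)%N; rewrite subnKC// => h.
have := metric_triangle (s k.+1).1 (s j).1 p; rewrite [mdist (s j).1 p]metric_sym.
have := (sG j).2; move: h pe.
move: (mdist _ _) (mdist _ _) (mdist _ _) (s _).2 (s _).2 => *; lra.
Qed.
End ProductGroups.

(** * Torsion *)

Section CentralInvolution.
Variables (Gam Del : groupType) (p : Gam -> Del) (S : Gam -> Prop).
Local Open Scope group_scope.

(** The commutator [h] of [z] and [x] and the square of [z] both lie over 1, hence commute with [S].
    Then [h * h = 1], so moving [z] past [x] twice produces no factor. *)
Lemma square_commutes (z x : Gam) : (forall w v, S w -> S v -> p w = 1 -> w * v = v * w) ->
  {morph p : a b / a * b} -> (forall a b, S a -> S b -> S (a * b)) ->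
  (forall a, S a -> S a^-1) -> S z -> S x ->
  p z * p x = p x * p z -> p z * p z = 1 -> z * (x * x) = x * x * z.
Proof.
move=> Hc pM SM SV Sz Sx zx zz.
have p1 : p 1 = 1 by apply: (mulgI (p 1)); rewrite -pM !mulg1.
have pV a : p a^-1 = (p a)^-1 by apply: (mulgI (p a)); rewrite -pM !mulgV.
pose h := z * x * (x * z)^-1.
have hx : z * x = h * (x * z) by rewrite /h mulgVK.
have Sh : S h by apply: (SM); [exact: SM|exact/SV/SM].
have ph : p h = 1 by rewrite pM pV !pM zx mulgV.
clearbody h.
have hz : h * z = z * h := Hc h z Sh Sz ph.
have hhx : h * x = x * h := Hc h x Sh Sx ph.
have z2x : z * z * x = x * (z * z).
  by apply: Hc => //; [exact: SM|rewrite pM].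
have hh : h * h = 1.
  have e : z * z * x = h * h * (x * z * z).
    by rewrite -(mulgA z z x) hx (mulgA z h) -hz -(mulgA h z) (mulgA z x z) hx !mulgA.
  by apply: (mulIg (x * z * z)); rewrite mul1g -e z2x mulgA.
by rewrite mulgA hx -!mulgA hx (mulgA x h) -hhx !mulgA hh mul1g.
Qed.

(* The commutator z of the squares depends only on the projections, up to
   elements commuting with everything in S; the relation p x ^ 4 = p z makes
   x ^ 4 / z such an element, so [x ^ 4, y ^ 2] equals both z ^ 2 and 1. *)
Lemma commutator_involution (x y : Gam) :
  (forall w v, S w -> S v -> p w = 1 -> w * v = v * w) ->
  {morph p : a b / a * b} -> (forall a b, S a -> S b -> S (a * b)) ->
  (forall a, S a -> S a^-1) -> S x -> S y ->
  let z := x * x * (y * y) * (y * y * (x * x))^-1 in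
  p z * p x = p x * p z -> p z * p y = p y * p z -> p z * p z = 1 ->
  p (x * x) * p (x * x) = p z -> S z /\ z * z = 1.
Proof.
move=> Hc pM SM SV Sx Sy z zx zy zz xz.
have p1 : p 1 = 1 by apply: (mulgI (p 1)); rewrite -pM !mulg1.
have pV a : p a^-1 = (p a)^-1 by apply: (mulgI (p a)); rewrite -pM !mulgV.
have Sxx : S (x * x) by exact: SM.
have Syy : S (y * y) by exact: SM.
have Sz : S z by apply: (SM); [exact: SM|exact/SV/SM].
split=> //.
have zxx := square_commutes Hc pM SM SV Sz Sx zx zz.
have zyy := square_commutes Hc pM SM SV Sz Sy zy zz.
have E : x * x * (y * y) = z * (y * y * (x * x)) by rewrite /z mulgVK.
move: (x * x) (y * y) Sxx Syy zxx zyy E xz => X Y SX SY zX zY E xz.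
clearbody z.
have aY : z^-1 * (X * X) * Y = Y * (z^-1 * (X * X)).
  apply: Hc => //; first by apply: (SM); [exact: SV|exact: SM].
  by rewrite pM pV pM xz mulVg.
have XXY : X * X * Y = z * z * Y * (X * X).
  by rewrite -mulgA E mulgA -zX -mulgA (mulgA X Y X) E !mulgA.
have zVY : z^-1 * Y = Y * z^-1.
  by apply: (mulgI z); rewrite mulVKg mulgA zY mulgK.
move: aY; rewrite -mulgA XXY !mulgA mulVg mul1g -zVY => aY.
have {}aY : z * Y = z^-1 * Y.
  by apply: (mulIg (X * X)); rewrite !mulgA.
have e : z = z^-1 by apply: (mulIg Y).
by rewrite {1}e mulVg.
Qed.
End CentralInvolution.

(** * Finitely many factors as block diagonal matrices *)

Section Embedding.
Variables (R : realType) (d : forall n, biinvariant_metric R n.+1).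
Local Notation C := (Cplx R).
Local Notation SUp := (SUprod d).
Implicit Types (x y : SUp).

(* The first M factors of the product, as block diagonal matrices. *)
Fixpoint block_dim M := if M is k.+1 then (block_dim k + k.+1)%N else 0%N.

Fixpoint block_embed M x : 'M[C]_(block_dim M) :=
  match M with
  | 0 => 1%:M
  | k.+1 => block_mx (block_embed k x) 0 0 (SUval (x k))
  end.

Lemma block_embedM M x y :
  block_embed M (x * y)%g = block_embed M x *m block_embed M y.
Proof.
elim: M => [|k IH] /=; first by rewrite mulmx1.
by rewrite mulmx_block !(mul0mx, mulmx0, addr0, add0r) IH.
Qed.

Lemma block_embed1 M : block_embed M (1%g : SUp) = 1%:M.
Proof. by elim: M => [//|k IH] /=; rewrite IH -scalar_mx_block. Qed.

Lemma block_embedV M x : block_embed M (x^-1)%g = (block_embed M x)^t*.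
Proof.
elim: M => [|k IH] /=; first by rewrite trmxC1.
rewrite tr_block_mx map_block_mx !trmx0 !map_mx0 -IH; congr (block_mx _ _ _ _).
exact: SUvalV.
Qed.

Lemma block_embed_unitary M x : block_embed M x \is unitarymx.
Proof. by apply/unitarymxP; rewrite -block_embedV -block_embedM mulgV block_embed1. Qed.

Lemma block_embed_inj M x y : block_embed M x = block_embed M y ->
  forall i, (i < M)%N -> x i = y i.
Proof.
elim: M => [//|k IH] /= /eq_block_mx[/IH h _ _ hk] i.
by rewrite ltnS leq_eqVlt => /orP[/eqP->|/h//]; exact: SUval_inj.
Qed.

Lemma nrm_block m n (A : 'M[C]_m) (B : 'M[C]_n) :
  nrm (block_mx A 0 0 B) <= nrm A + nrm B.
Proof.
rewrite nrmE -[leRHS]ger0_norm ?addr_ge0 ?nrm_ge0// -sqrtr_sqr ler_sqrt ?sqr_ge0//.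
have -> : nsq (block_mx A 0 0 B) = nsq A + nsq B.
  rewrite -!rtr_sq tr_block_mx map_block_mx !trmx0 !map_mx0 mulmx_block.
  by rewrite !(mul0mx, mulmx0, addr0, add0r) !rtr.unlock mxtrace_block creD.
by rewrite -!nrm_sq sqrrD addrAC lerDl mulrn_wge0// mulr_ge0 ?nrm_ge0.
Qed.

Lemma mcvg_block_embed M (u : nat -> SUp) x :
  (forall n, mcvg (fun i => SUval (u i n)) (SUval (x n))) ->
  mcvg (fun i => block_embed M (u i)) (block_embed M x).
Proof.
move=> ux; elim: M => [|k IH] /=; first exact: mcvg_cst.
apply: (@mcvg_squeeze _ _ _ _ _ (fun i => nrm (block_embed k (u i) - block_embed k x) +
  nrm (SUval (u i k) - SUval (x k)))) => [i|].
  by rewrite opp_block_mx add_block_mx !oppr0 !addr0 nrm_block.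
by rewrite -[X in _ --> X](addr0 0); apply: cvgD; [exact: IH|exact: ux].
Qed.
End Embedding.

(** * Lifting to centralizers and producing involutions *)

Section Torsion.
Variables (R : realType) (d : forall n, biinvariant_metric R n.+1).
Local Notation C := (Cplx R).
Local Notation SUp := (SUprod d).
Implicit Types (x y g : SUp) (G H : compact_subgroup d).

Lemma subgroup_1 G : subgroup_set G 1%g.
Proof.
have [x Gx] := subgroup_neq0 G; rewrite -(mulgV x).
by apply: subgroup_mul => //; exact: subgroup_inv.
Qed.

Lemma subgroup_subsequence G (u : nat -> SUp) : (forall i, subgroup_set G (u i)) ->
  exists x, subgroup_set G x /\ exists2 phi, subsequence phi &
    forall n, mcvg (fun i => SUval (u (phi i) n)) (SUval (x n)).
Proof.
move=> Gu; have [x [Gx [phi hphi cx]]] := compact_subsequence (subgroup_compact (c := G)) Gu.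
by exists x; split => //; exists phi => // n; exact: cvg_coord cx.
Qed.

Section FixedProjection.
Variables (m : nat) (G : compact_subgroup d).
Local Notation N := m.+1.

Definition kernel_elt x := subgroup_set G x /\ x N = 1%g.

Lemma kernel_eltM x y : kernel_elt x -> kernel_elt y -> kernel_elt (x * y)%g.
Proof.
move=> [Gx x1] [Gy y1]; split; first exact: subgroup_mul.
by rewrite -[LHS]/(x N * y N)%g x1 y1 mulg1.
Qed.

Lemma kernel_eltV x : kernel_elt x -> kernel_elt (x^-1)%g.
Proof.
move=> [Gx x1]; split; first exact: subgroup_inv.
by rewrite -[LHS]/((x N)^-1)%g x1 invg1.
Qed.

Lemma kernel_eltJ x y : kernel_elt x -> subgroup_set G y -> kernel_elt (x * y * x^-1 * y^-1)%g.
Proof.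
move=> [Gx x1] Gy; split.
  apply: subgroup_mul; last exact: subgroup_inv.
  by apply: subgroup_mul; [exact: subgroup_mul|exact: subgroup_inv].
rewrite -[LHS]/(x N * y N * (x N)^-1 * (y N)^-1)%g x1 mul1g invg1 mulg1.
exact: mulgV.
Qed.

Definition kernel_mx M : set 'M[C]_(block_dim M) :=
  [set block_embed M x | x in kernel_elt].

Arguments kernel_mx : clear implicits.

Lemma kernel_ugroup M : ugroup (kernel_mx M).
Proof.
split.
- by move=> _ [x _ <-]; exact: block_embed_unitary.
- by exists 1%g; [split => //; exact: subgroup_1|exact: block_embed1].
- move=> _ _ [x Kx <-] [y Ky <-]; exists (x * y)%g; first exact: kernel_eltM.
  exact: block_embedM.
- move=> _ [x Kx <-]; exists (x^-1)%g; first exact: kernel_eltV.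
  exact: block_embedV.
Qed.

Lemma kernel_seqcompact M : seqcompact (kernel_mx M).
Proof.
move=> u Ku; have /choice[x xP] : forall i, exists x, kernel_elt x /\ block_embed M x = u i.
  by move=> i; have [x Kx e] := Ku i; exists x.
have [y [Gy [phi hphi cy]]] := @subgroup_subsequence G x (fun i => (xP i).1.1).
exists (block_embed M y); split.
  exists y => //; split => //; apply: SUval_inj; apply: mcvg_unique (cy N) _.
  by apply: mcvg_eq (mcvg_cst _) => i; rewrite (xP (phi i)).1.2.
exists phi => //; apply: mcvg_eq (mcvg_block_embed M cy) => i.
exact: (xP (phi i)).2.
Qed.

(** Commutation is required only in the first [M] factors, where the kernel becomes a compact group
    of matrices of finite size. *)
Definition centralizing M x := subgroup_set G x /\
  forall k, kernel_elt k -> block_embed M (k * x)%g = block_embed M (x * k)%g.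

Lemma centralizingM M x y : centralizing M x -> centralizing M y -> centralizing M (x * y)%g.
Proof.
move=> [Gx cx] [Gy cy]; split=> [|k Kk]; first exact: subgroup_mul.
have := cx k Kk; have := cy k Kk; rewrite !block_embedM => hy hx.
by rewrite mulmxA hx -mulmxA hy mulmxA.
Qed.

Lemma centralizingV M x : centralizing M x -> centralizing M (x^-1)%g.
Proof.
move=> [Gx cx]; split=> [|k Kk]; first exact: subgroup_inv.
have := cx k Kk; rewrite !block_embedM block_embedV => h.
have u := block_embed_unitary M x.
rewrite -[LHS]mul1mx -(unit_Vmul u) -mulmxA [X in _ *m X]mulmxA -h -mulmxA.
by rewrite unit_mulV// mulmx1.
Qed.

Lemma centralizingX M x k : centralizing M x -> centralizing M (x ^+ k)%g.
Proof.
move=> Cx; elim: k => [|k IH]; last by rewrite expgS; exact: centralizingM.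
by split=> [|k _]; [exact: subgroup_1|rewrite mulg1 mul1g].
Qed.

Variable r : R.
Hypothesis r0 : 0 < r.
Hypothesis full_proj : forall u : SU R N.+1, nrm (SUval u - 1%:M) < r ->
  exists2 x, subgroup_set G x & x N = u.

(** Lifts of the [v i] accumulate at some [y] over 1. Dividing by [y] gives lifts close to 1, and
    [centralizing_representative] corrects one of them by a kernel element, which leaves the
    coordinate [N] unchanged. *)
Lemma centralizing_lift M (v : nat -> SU R N.+1) : mcvg (fun i => SUval (v i)) 1%:M ->
  exists k x, centralizing M x /\ x N = v k.
Proof.
move=> cv; have [e e0 He] := centralizing_representative (kernel_ugroup M) (@kernel_seqcompact M).
have [n0 Hn0] := mcvg_nearby cv r0.
have /choice[x xP] : forall i, exists x, subgroup_set G x /\ x N = v (i + n0)%N.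
  by move=> i; have [x Gx xv] := full_proj (Hn0 (i + n0)%N (leq_addl _ _)); exists x.
have [y [Gy [phi hphi cy]]] := @subgroup_subsequence G x (fun i => (xP i).1).
have yN : y N = 1%g.
  apply: SUval_inj; apply: mcvg_unique (cy N) _.
  have h : subsequence (fun i => phi i + n0)%N by move=> i; rewrite -addSn leq_add2r.
  by apply: mcvg_eq (mcvg_sub h cv) => i; rewrite /= (xP (phi i)).2.
have [n1 Hn1] := mcvg_nearby (mcvg_block_embed M cy) e0.
have := Hn1 n1 (leqnn _); set z := x (phi n1) => zy.
have Gz : subgroup_set G z := (xP (phi n1)).1.
pose w := (y^-1 * z)%g.
have Gw : subgroup_set G w by apply: subgroup_mul => //; exact: subgroup_inv.
have wN : w N = v (phi n1 + n0)%N.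
  by rewrite -[LHS]/((y N)^-1 * x (phi n1) N)%g yN invg1 mul1g (xP (phi n1)).2.
have we : nrm (block_embed M w - 1%:M) < e.
  rewrite -(nrmUl _ (block_embed_unitary M y)) mulmxBr mulmx1 -block_embedM.
  by rewrite /w mulVKg.
clearbody w; have [|_ [k Kk <-] Hk] := He _ (block_embed_unitary M w) _ we.
  move=> _ [k Kk <-]; exists (k * w * k^-1 * w^-1)%g; first exact: kernel_eltJ.
  by rewrite !block_embedM !block_embedV.
exists (phi n1 + n0)%N, (k * w)%g; split; last first.
  by rewrite -[LHS]/(k N * w N)%g Kk.2 mul1g.
split; first by apply: subgroup_mul => //; exact: Kk.1.
move=> l Kl; rewrite !block_embedM; apply: Hk; by exists l.
Qed.

Lemma phaseSU_pow (t : R) k : (phaseSU m t ^+ k)%g = phaseSU m (k%:R * t).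
Proof. by apply: SUval_inj; rewrite SUval_pow /= phase_pow. Qed.
Lemma rotSU_pow (t : R) k : (rotSU m t ^+ k)%g = rotSU m (k%:R * t).
Proof. by apply: SUval_inj; rewrite SUval_pow /= planerot_pow. Qed.

Lemma phaseSUD (s t : R) : (phaseSU m s * phaseSU m t)%g = phaseSU m (s + t).
Proof. by apply: SUval_inj; rewrite SUvalM /= phaseD. Qed.
Lemma rotSUD (s t : R) : (rotSU m s * rotSU m t)%g = rotSU m (s + t).
Proof. by apply: SUval_inj; rewrite SUvalM /= planerotD. Qed.

Lemma truncated_involution M : (N < M)%N -> exists z, [/\ subgroup_set G z,
  z N = phaseSU m pi & forall i, (i < M)%N -> (z i * z i)%g = 1%g].
Proof.
(* At angle [pi / 4] the squares lie over the two quaternion units, and the fourth power of [x] lies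
   over -1, as [commutator_involution] demands. Only small angles lift directly; the powers [k1.+1]
   and [k2.+1] then restore [q]. *)
move=> NM; pose q : R := pi / 4.
have [k1 [x0 [Cx0 x0N]]] := @centralizing_lift M (fun k => phaseSU m (q / k.+1%:R)) (mcvg_phase m q).
have [k2 [y0 [Cy0 y0N]]] := @centralizing_lift M (fun k => rotSU m (q / k.+1%:R)) (mcvg_rot m q).
pose x := (x0 ^+ k1.+1)%g; pose y := (y0 ^+ k2.+1)%g.
have Cx : centralizing M x by exact: centralizingX.
have Cy : centralizing M y by exact: centralizingX.
have xN : x N = phaseSU m q.
  by rewrite /x SUprod_powE x0N phaseSU_pow mulrC divfK ?pnatr_eq0.
have yN : y N = rotSU m q.
  by rewrite /y SUprod_powE y0N rotSU_pow mulrC divfK ?pnatr_eq0.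
pose tr (g : SUp) : SUp := @truncate R d M g.
have trE g i : (i < M)%N -> tr g i = g i by rewrite /tr /truncate => ->.
have trM a b : tr (a * b)%g = (tr a * tr b)%g.
  apply: functional_extensionality_dep => i.
  rewrite -[RHS]/(tr a i * tr b i)%g /tr /truncate; case: ifP => // _.
  by rewrite mulg1.
have trV a : tr (a^-1)%g = ((tr a)^-1)%g.
  apply: functional_extensionality_dep => i.
  rewrite -[RHS]/((tr a i)^-1)%g /tr /truncate; case: ifP => // _.
  by rewrite invg1.
(* Truncation to the first [M] factors turns commutation there into an equality in the product
   group. *)
pose S (w : SUp) := exists2 c, centralizing M c & tr c = w.
pose p (w : SUp) := w N.
have pM : {morph p : a b / (a * b)%g} by [].
have SM a b : S a -> S b -> S (a * b)%g.
  move=> [c Cc <-] [c' Cc' <-]; exists (c * c')%g; first exact: centralizingM.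
  exact: trM.
have SV a : S a -> S (a^-1)%g.
  by move=> [c Cc <-]; exists (c^-1)%g; [exact: centralizingV|exact: trV].
have Hc w v : S w -> S v -> p w = 1%g -> (w * v = v * w)%g.
  move=> [c Cc <-] [c' Cc' <-]; rewrite /p trE// => cN.
  rewrite -!trM; apply: functional_extensionality_dep => i.
  have [iM|iM] := boolP (i < M)%N; last by rewrite /tr /truncate (negPf iM).
  rewrite !trE//; apply: (block_embed_inj (M := M)) iM.
  by have [_] := Cc'; apply; split => //; exact: Cc.1.
have ptrx : p (tr x) = phaseSU m q by rewrite /p trE.
have ptry : p (tr y) = rotSU m q by rewrite /p trE.
have ph : q + q = pi / 2 :> R by rewrite /q; field.
have ph2 : pi / 2 + pi / 2 = pi :> R by field.
have zN : p (tr x * tr x * (tr y * tr y) * (tr y * tr y * (tr x * tr x))^-1)%g = phaseSU m pi.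
  have pV (a : SUp) : p (a^-1)%g = ((p a)^-1)%g by [].
  rewrite !(pM, pV) ptrx ptry phaseSUD rotSUD ph.
  apply: (mulIg (rotSU m (pi / 2) * phaseSU m (pi / 2))%g); rewrite mulgVK.
  by apply: SUval_inj; rewrite !SUvalM /=; exact: phase_rot_half.
have Sx : S (tr x) by exists x.
have Sy : S (tr y) by exists y.
have [] := commutator_involution Hc pM SM SV Sx Sy.
- by rewrite zN ptrx !phaseSUD addrC.
- rewrite zN ptry; apply: SUval_inj; rewrite !SUvalM /=; exact: phase_pi_rotC.
- rewrite zN; apply: SUval_inj; rewrite !SUvalM /=; exact: phase_pi_sq.
- by rewrite zN !pM ptrx !phaseSUD ph ph2.
move=> [c Cc cE] zz; exists c; split; first exact: Cc.1.
  by rewrite -zN -cE /p trE.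
move=> i iM; rewrite -[LHS]/((c * c)%g i) -(trE _ _ iM) trM cE zz.
by [].
Qed.

(** A limit of the truncated involutions: the coordinate [N] is always [phaseSU m pi], so the limit
    is not 1, and each coordinate eventually squares to 1. *)
Lemma torsion_of_full_projection : exists g : SUp,
  [/\ subgroup_set G g, g <> 1%g & has_finite_order g].
Proof.
have /choice[z zP] : forall k, exists z, [/\ subgroup_set G z,
    z N = phaseSU m pi & forall i, (i < N.+1 + k)%N -> (z i * z i)%g = 1%g].
  by move=> k; apply: truncated_involution; rewrite addSn ltnS leq_addr.
have Gz k : subgroup_set G (z k) by have [] := zP k.
have [g [Gg [phi hphi cg]]] := subgroup_subsequence Gz.
exists g; split => //.
- move=> g1; have /eqP := phase_pi_neq1 R m; apply.
  have gN : g N = phaseSU m pi.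
    apply: SUval_inj; apply: mcvg_unique (cg N) _.
    by apply: mcvg_eq (mcvg_cst _) => i; have [_ -> _] := zP (phi i).
  by move: gN; rewrite g1 => /(congr1 (@SUval R _))/esym.
- exists 2%N => //; rewrite expg2; apply: functional_extensionality_dep => n.
  rewrite -[LHS]/(g n * g n)%g; apply: SUval_inj; rewrite SUvalM.
  have h : subsequence (fun i => i + n)%N by move=> i; rewrite addSn.
  apply: (mcvg_unique (mcvg_sub h (mcvgM (cg n) (cg n)))).
  apply: mcvg_eq (mcvg_cst _) => i /=.
  rewrite -SUvalM; have [_ _ ->] := zP (phi (i + n)%N); first by [].
  apply: (@leq_trans (N.+1 + (i + n))%N); first by rewrite addSn ltnS addnA leq_addl.
  by rewrite leq_add2l subsequence_ge.
Qed.
End FixedProjection.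

Lemma torsion_dense G e : 0 < e -> exists H, mdist G H < e /\
  exists2 r, 0 < r & forall G', mdist H G' < r -> exists g : SUp,
    [/\ subgroup_set G' g, g <> 1%g & has_finite_order g].
Proof.
move=> e0; have [m me] := pow2_lt e0.
exists (coord_group m.+1 G); split; first exact: le_lt_trans (coord_group_dist _ _) me.
have [e2 e20 HJ] := @dense_subgroup_SU R m.
have [r r0 rH] := bm_dist_nrm (d m.+1) e20.
have p0 : 0 < 2 ^+ m.+2 :> R by rewrite exprn_gt0.
(* The coordinate of index [m.+1] has weight [2 ^- m.+2] in the product metric, so the projection of
   [G'] to it is dense up to [e2] in the Frobenius norm. *)
exists (r / 2 ^+ m.+2); first by rewrite divr_gt0.
move=> G' HG'.
pose J := [set SUval (x m.+1) | x in subgroup_set G'].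
have [||||s s0 sH] := HJ J.
- split.
  + by move=> _ [x _ <-]; exact: SUval_unitary.
  + by exists 1%g => //; exact: subgroup_1.
  + by move=> _ _ [x Gx <-] [y Gy <-]; exists (x * y)%g => //; exact: subgroup_mul.
  + move=> _ [x Gx <-]; exists (x^-1)%g; first exact: subgroup_inv.
    exact: SUvalV.
- move=> u Ju; have /choice[x xP] : forall i, exists x, subgroup_set G' x /\ SUval (x m.+1) = u i.
    by move=> i; have [x Gx xe] := Ju i; exists x.
  have [y [Gy [phi hphi cy]]] := @subgroup_subsequence G' x (fun i => (xP i).1).
  exists (SUval (y m.+1)); split; first by exists y.
  by exists phi => //; apply: mcvg_eq (cy m.+1) => i; exact: (xP (phi i)).2.
- by move=> _ [x _ <-]; exact: SUval_SU.
- move=> g sg; have [x Gx] := subgroup_neq0 G.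
  have [y Gy xy] := hausdorff_near HG' (coord_set_in (MkSU sg) Gx).
  exists (SUval (y m.+1)); first by exists y.
  have := rH (MkSU sg) (y m.+1); apply.
  have := coord_dist (with_coord x (MkSU sg)) y m.+1; rewrite with_coordN.
  move=> /le_lt_trans; apply.
  by rewrite mulrC -ltr_pdivlMr.
apply: (@torsion_of_full_projection m G' s s0) => u us.
by have [x Gx xu] := sH _ (SUval_SU u) us; exists x => //; exact: SUval_inj.
Qed.

Lemma dense_interior (A : set (compact_subgroup d)) :
  (forall G e, 0 < e -> exists H, mdist G H < e /\
    exists2 r, 0 < r & forall G', mdist H G' < r -> A G') ->
  dense (interior A).
Proof.
move=> HA O [G OG] oO; have /nbhs_ballP[e /= e0 eO] := open_nbhs_nbhs (conj oO OG).
have [H [GH [r r0 rA]]] := HA G e e0; exists H; split.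
  by apply: eO; rewrite ballEmdist.
by apply/nbhs_ballP; exists r => //= G'; rewrite ballEmdist; exact: rA.
Qed.
End Torsion.

Theorem theorem5p27 (R : realType)
    (d : forall n : nat, biinvariant_metric R n.+1) :
  comeager [set G : compact_subgroup d |
    (exists g : SUprod d, [/\ subgroup_set G g, g <> 1%g & has_finite_order g]) /\
    (exists g : SUprod d, subgroup_set G g /\ ~ has_finite_order g)].
Proof.
(* Index 0 carries the torsion condition, and the later indices carry the approximate conditions
   whose conjunction gives an element of infinite order. *)
pose A k := if k is k'.+1 then [set G : compact_subgroup d | almost_nontorsion k' G]
  else [set G : compact_subgroup d | exists g : SUprod d,
    [/\ subgroup_set G g, g <> 1%g & has_finite_order g]].
exists (fun k => interior (A k)).
  move=> k; split; first exact: open_interior.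
  apply: dense_interior => G e e0; case: k => [|k]; first exact: torsion_dense.
  exact: almost_nontorsion_dense.
move=> G AG; have sub k : A k G := interior_subset (AG k I).
split; first exact: (sub 0%N).
by apply: nontorsion_of_almost => k; exact: (sub k.+1).
Qed.
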